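(* Let $r\in(0,\infty)$, let $P=f\cdot\lambda_d$ be an absolutely continuous Borel probability measure on $\mathbb{R}^d$ with $\int\|x\|^{r+\delta}\,dP(x)<+\infty$ for some $\delta>0$, and for every $n\ge1$ let $\alpha_n$ be an $L^r$-optimal $n$-quantizer for $P$. (a) Assume that there are a norm $\|\cdot\|_0$ on $\mathbb{R}^d$, a real number $N\ge0$ and a nonincreasing function $h:(N,\infty)\to\mathbb{R}_+$ such that $f(x)=h(\|x\|_0)$ for all $x$ with $\|x\|_0>N$. Let $s\in(r,d+r)$. If $$\int f(cx)^{-s/(d+r)}\,dP(x)<+\infty$$ for some $c>1$, then $$\sup_n n^{s/d}\int d(x,\alpha_n)^s\,dP(x)<+\infty.$$ (b) Assume $d=1$ and $s\in(1,1+r)$. Assume that $\mathrm{supp}(P)\subset[R_0,\infty)$ for some $R_0\in\mathbb{R}$ and that $f|_{(R_0',\infty)}$ is nonincreasing for some $R_0'\ge R_0$. Assume furthermore that $$\int f(cx)^{-s/(1+r)}\,dP(x)<+\infty$$ for some $c>1$. Then $$\sup_n n^{s}\int d(x,\alpha_n)^s\,dP(x)<+\infty.$$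
   Context: $\mathbb{R}^d$ ($d\ge 1$) is equipped with an arbitrary norm $\|\cdot\|$ (the absolute value when $d=1$); $d(x,A)=\inf_{a\in A}\|x-a\|$; $\lambda_d$ is Lebesgue measure. Negative powers of $0$ are $+\infty$. An $L^r$-optimal $n$-quantizer for $P$ is a nonempty set $\alpha\subset\mathbb{R}^d$ with $\mathrm{card}(\alpha)\le n$ minimizing $\int d(x,\alpha)^r\,dP(x)$ among all nonempty subsets of $\mathbb{R}^d$ of cardinality at most $n$ (distances measured with $\|\cdot\|$). *)

(* Defs.v *)
From HB Require Import structures.
From mathcomp Require Import all_boot all_order all_algebra.
From mathcomp Require Import all_classical all_reals all_analysis.
From mathcomp Require Import measurable_realfun.

Set Implicit Arguments.
Unset Strict Implicit.
Unset Printing Implicit Defensive.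
Import Order.TTheory GRing.Theory Num.Theory.
Import numFieldTopology.Exports numFieldNormedType.Exports.

Local Open Scope classical_set_scope.
Local Open Scope ring_scope.

Fact rV_borel_display : measure_display.
Proof. exact: default_measure_display. Qed.

Section rV_borel.
Context (R : realType) (d : nat).

Definition rV_borel : set (set 'rV[R]_d) := <<s @open 'rV[R]_d >>.

Let rV_borel0 : rV_borel set0.
Proof. exact: sigma_algebra0. Qed.

Let rV_borelC A : rV_borel A -> rV_borel (~` A).
Proof. exact: sigma_algebraC. Qed.

Let rV_borel_bigcup (F : (set 'rV[R]_d)^nat) :
  (forall i, rV_borel (F i)) -> rV_borel (\bigcup_i F i).
Proof. exact: sigma_algebra_bigcup. Qed.

HB.instance Definition _ := @isMeasurable.Build rV_borel_display
  'rV[R]_d rV_borel rV_borel0 rV_borelC rV_borel_bigcup.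

End rV_borel.

Section rV_measurability.
Context (R : realType).

Lemma measurable_coord d (i : 'I_d) :
  measurable_fun [set: 'rV[R]_d] (fun x => x ord0 i : measurableTypeR R).
Proof.
apply: (measurability _ (RGenOpens.measurableE R)).
move=> _ [_ [a [b ->] <-]]; rewrite setTI; apply: sub_sigma_algebra.
by apply: open_comp; [move=> x _; exact: coord_continuous|exact: interval_open].
Qed.

Lemma rV_open_bigcup d (A : set 'rV[R]_d) : open A -> A =
  \bigcup_(q in [set q : 'rV[rat]_d * nat |
      ball (map_mx ratr q.1 : 'rV[R]_d) q.2.+1%:R^-1 `<=` A])
    ball (map_mx ratr q.1 : 'rV[R]_d) q.2.+1%:R^-1.
Proof.
move=> oA; apply/seteqP; split => [x Ax|x [q /= + qx]]; last exact.
have /nbhs_ballP[_/posnumP[e] xeA] : nbhs x A by exact: open_nbhs_nbhs.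
have [k ke] : exists k : nat, k.+1%:R^-1 < e%:num / 2.
  have e20 : 0 < e%:num / 2 by rewrite divr_gt0.
  have [k _ /(_ k (leqnn k)) /=] := near_infty_natSinv_lt (PosNum e20).
  by exists k.
have k0 : 0 < k.+1%:R^-1 :> R by rewrite invr_gt0.
have qP i : {q : rat | `|x ord0 i - ratr q| < k.+1%:R^-1}.
  apply: cid.
  have /rat_in_itvoo[q] : x ord0 i - k.+1%:R^-1 < x ord0 i + k.+1%:R^-1.
    by rewrite ltrD2l (lt_trans _ k0)// oppr_lt0.
  rewrite in_itv/= => /andP[q1 q2]; exists q.
  by rewrite ltr_distlC q1 q2.
pose q : 'rV[rat]_d := \row_i sval (qP i).
have xq i : `|x ord0 i - ratr (q ord0 i)| < k.+1%:R^-1.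
  by rewrite mxE; exact: (svalP (qP i)).
exists (q, k) => /=.
  move=> y qy; apply: xeA; rewrite [e%:num]splitr.
  apply: (@ball_triangle R 'rV[R]_d (map_mx ratr q)).
    split; first by rewrite divr_gt0.
    by move=> i j; rewrite !ord1 [map_mx _ _ _ _]mxE; exact: lt_trans (xq j) ke.
  by apply: le_ball qy; exact: ltW.
split => // i j; rewrite !ord1 [map_mx _ _ _ _]mxE; apply: ball_sym.
exact: xq.
Qed.

Lemma measurable_fun_rV dT (T : measurableType dT) d (g : T -> 'rV[R]_d) :
  (forall i,
    measurable_fun [set: T] (fun x => g x ord0 i : measurableTypeR R)) ->
  measurable_fun [set: T] g.
Proof.
move=> mg; apply: (@measurability _ _ _ _ _ _ (@open 'rV[R]_d)) => //.
move=> _ [A oA <-]; rewrite setTI (rV_open_bigcup oA) preimage_bigcup.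
rewrite bigcup_mkcond; apply: countable_bigcupT_measurable => // q.
case: ifPn => // _.
have -> : g @^-1` ball (map_mx ratr q.1 : 'rV[R]_d) q.2.+1%:R^-1 =
    \bigcap_(i in [set: 'I_d])
    ((fun x => g x ord0 i) @^-1` ball (ratr (q.1 ord0 i) : R) q.2.+1%:R^-1).
  apply/seteqP; split => x /=.
    by move=> [_ h] i _ /=; have := h ord0 i; rewrite !mxE.
  by move=> h; split => // i j; rewrite !ord1 !mxE; exact: h.
apply: fin_bigcap_measurable => // i _.
rewrite -[X in measurable X]setTI; apply: mg => //.
by apply: open_measurable; exact: ball_open.
Qed.

Definition rV_cons d (xy : measurableTypeR R * 'rV[R]_d) : 'rV[R]_d.+1 :=
  row_mx (xy.1%:M : 'rV[R]_1) xy.2.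

Definition rV_uncons d (z : 'rV[R]_d.+1) : measurableTypeR R * 'rV[R]_d :=
  (z ord0 ord0, rsubmx (z : 'rV[R]_(1 + d))).

Lemma rV_cons0 d (x : R) (y : 'rV[R]_d) : rV_cons (x, y) ord0 ord0 = x.
Proof.
rewrite /rV_cons /row_mx mxE; case: splitP => [j _|//].
by rewrite [j]ord1 mxE eqxx mulr1n.
Qed.

Lemma rV_consS d (x : R) (y : 'rV[R]_d) (j : 'I_d) :
  rV_cons (x, y) ord0 (lift ord0 j) = y ord0 j.
Proof.
rewrite /rV_cons /row_mx mxE; case: splitP => [k|k].
  by rewrite ord1 lift0.
by rewrite lift0 => -[jk]; congr (y _ _); exact/esym/val_inj.
Qed.

Lemma measurable_rV_cons d : measurable_fun setT (@rV_cons d).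
Proof.
apply: measurable_fun_rV => i.
case: (unliftP ord0 i) => [j ->|->].
  rewrite (_ : (fun x => _) = (fun v : 'rV[R]_d => v ord0 j) \o snd).
    exact: (measurableT_comp (@measurable_coord d j)).
  by apply/funext => -[x y]; rewrite rV_consS.
rewrite (_ : (fun x => _) = fst); first exact: measurable_fst.
by apply/funext => -[x y]; rewrite rV_cons0.
Qed.

Lemma measurable_rV_uncons d : measurable_fun setT (@rV_uncons d).
Proof.
apply/measurable_fun_pairP; split; first exact: measurable_coord.
apply: measurable_fun_rV => i /=.
under eq_fun do rewrite mxE.
exact: measurable_coord.
Qed.

Lemma rV_consK d : cancel (@rV_cons d) (@rV_uncons d).
Proof.
by move=> [x y]; rewrite /rV_uncons rV_cons0 /rV_cons row_mxKr.
Qed.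

End rV_measurability.

(* [lebesgue_measure \x lebesgue_rV d] transported along the identification of
   R * R^d with R^(d+1); on R^0 the Lebesgue measure is the unit mass. *)
Fixpoint lebesgue_rV (R : realType) (d : nat) : set 'rV[R]_d -> \bar R :=
  match d with
  | 0 => \d_(0 : 'rV[R]_0)
  | d'.+1 =>
    pushforward (lebesgue_measure \x @lebesgue_rV R d')%E (@rV_cons R d')
  end.

Section lebesgue_rV_measure.
Context (R : realType).

Lemma lebesgue_rV_sigma_finite_measure d :
  exists mu : {sigma_finite_measure set 'rV[R]_d -> \bar R},
    mu = @lebesgue_rV R d :> (set 'rV[R]_d -> \bar R).
Proof.
elim: d => [|d [mu IH]]; first by exists \d_(0 : 'rV[R]_0).
pose nu : set 'rV[R]_d.+1 -> \bar R :=
  pushforward (@lebesgue_measure R \x mu)%E (@rV_cons R d).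
have nu0 : nu set0 = 0%E by rewrite /nu /pushforward preimage_set0 measure0.
have mc A : measurable A -> measurable (@rV_cons R d @^-1` A).
  by move=> mA; rewrite -[X in measurable X]setTI; exact: measurable_rV_cons.
have nu_ge0 A : (0 <= nu A)%E by apply: integral_ge0 => x _; exact: measure_ge0.
have nu_sigma : semi_sigma_additive nu.
  move=> F mF tF mUF; rewrite /nu /pushforward preimage_bigcup.
  apply: measure_semi_sigma_additive.
  - by move=> n; exact: mc.
  - apply/trivIsetP => i j _ _ ij; rewrite -preimage_setI.
    by move/trivIsetP : tF => /(_ _ _ _ _ ij) ->//; rewrite preimage_set0.
  - by rewrite -preimage_bigcup; exact: mc.
have nuF : sigma_finite setT nu.
  have /sigma_finiteP[F [FT ndF Foo]] := sigma_finiteT (@lebesgue_measure R).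
  have /sigma_finiteP[G [GT ndG Goo]] := sigma_finiteT mu.
  exists (fun n => @rV_uncons R d @^-1` (F n `*` G n)).
    rewrite -preimage_bigcup -[LHS](preimage_setT (@rV_uncons R d)).
    congr (_ @^-1` _); rewrite -setXTT FT GT; apply/seteqP; split.
      move=> [x y] [/= [n _ Fnx] [k _ Gky]]; exists (maxn n k) => //; split.
        by move: x Fnx; exact/subsetPset/ndF/leq_maxl.
      by move: y Gky; exact/subsetPset/ndG/leq_maxr.
    by move=> [x y] [n _ []/= ? ?]; split; exists n.
  move=> n; have [mF Fn] := Foo n; have [mG Gn] := Goo n; split.
    rewrite -[X in measurable X]setTI.
    by apply: measurable_rV_uncons => //; exact: measurableX.
  rewrite /nu /pushforward -comp_preimage.
  rewrite (_ : _ \o _ = id); last by apply/funext => z /=; rewrite rV_consK.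
  rewrite preimage_id product_measure1E//.
  by rewrite lte_mul_pinfty// ge0_fin_numE.
have nuE : nu = @lebesgue_rV R d.+1 by rewrite /nu IH.
clearbody nu.
pose nuM := isMeasure.Build _ _ _ nu nu0 nu_ge0 nu_sigma.
pose nu' : {measure set 'rV[R]_d.+1 -> \bar R} := HB.pack nu nuM.
pose nuSF := Measure_isSigmaFinite.Build _ _ _ nu' nuF.
by exists (HB.pack nu nuM nuSF :
  {sigma_finite_measure set 'rV[R]_d.+1 -> \bar R}).
Qed.

Let lebesgue_rV0 d : @lebesgue_rV R d set0 = 0%E.
Proof. by have [mu <-] := lebesgue_rV_sigma_finite_measure d. Qed.

Let lebesgue_rV_ge0 d A : (0 <= @lebesgue_rV R d A)%E.
Proof. by have [mu <-] := lebesgue_rV_sigma_finite_measure d. Qed.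

Let lebesgue_rV_sigma_additive d : semi_sigma_additive (@lebesgue_rV R d).
Proof.
have [mu <-] := lebesgue_rV_sigma_finite_measure d.
exact: measure_semi_sigma_additive.
Qed.

HB.instance Definition _ d := isMeasure.Build _ _ _ (@lebesgue_rV R d)
  (@lebesgue_rV0 d) (@lebesgue_rV_ge0 d) (@lebesgue_rV_sigma_additive d).

Let lebesgue_rV_sigma_finite d : sigma_finite setT (@lebesgue_rV R d).
Proof.
by have [mu <-] := lebesgue_rV_sigma_finite_measure d; exact: sigma_finiteT.
Qed.

HB.instance Definition _ d := Measure_isSigmaFinite.Build _ _ _
  (@lebesgue_rV R d) (@lebesgue_rV_sigma_finite d).

Lemma lebesgue_rV_box d (a b : 'rV[R]_d) : (forall i, a ord0 i <= b ord0 i) ->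
  lebesgue_rV [set x : 'rV[R]_d | forall i, a ord0 i <= x ord0 i <= b ord0 i] =
  (\prod_(i < d) (b ord0 i - a ord0 i))%:E.
Proof.
elim: d a b => [|d IH] a b ab.
  by rewrite big_ord0 /= diracE mem_set//=; case.
pose a' : 'rV[R]_d := \row_j a ord0 (lift ord0 j).
pose b' : 'rV[R]_d := \row_j b ord0 (lift ord0 j).
pose B := [set x : 'rV[R]_d | forall i, a' ord0 i <= x ord0 i <= b' ord0 i].
have mB : measurable B.
  rewrite (_ : B = \bigcap_(i in [set: 'I_d])
      ((fun x => x ord0 i) @^-1` `[a' ord0 i, b' ord0 i]%classic)).
    apply: fin_bigcap_measurable => // i _; rewrite -[X in measurable X]setTI.
    exact: measurable_coord.
  by apply/seteqP; split => x /= h i; have := h i; rewrite /= in_itv//=; apply.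
rewrite /= /pushforward.
rewrite (_ : _ @^-1` _ = `[a ord0 ord0, b ord0 ord0]%classic `*` B); last first.
  apply/seteqP; split => -[x y] /=.
    move=> h; split; first by have := h ord0; rewrite rV_cons0 in_itv.
    by move=> i; have := h (lift ord0 i); rewrite rV_consS !mxE.
  move=> [x0 h] i; case: (unliftP ord0 i) => [j ->|->].
    by have := h j; rewrite rV_consS !mxE.
  by rewrite rV_cons0; move: x0; rewrite in_itv.
rewrite product_measure1E// big_ord_recl EFinM.
have L : @lebesgue_measure R `[a ord0 ord0, b ord0 ord0]%classic =
    (b ord0 ord0 - a ord0 ord0)%:E.
  rewrite lebesgue_measure_itv/= lte_fin -EFinB.
  by case: ltgtP (ab ord0) => [//|//|->] _; rewrite subrr.
have IHB : lebesgue_rV B = (\prod_(i < d) (b' ord0 i - a' ord0 i))%:E.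
  by apply: IH => i; rewrite !mxE.
rewrite [X in (X * _)%E]L [X in (_ * X)%E]IHB; congr (_ * EFin _)%E.
by apply: eq_bigr => i _; rewrite !mxE.
Qed.

End lebesgue_rV_measure.

Record is_norm (R : realType) (V : lmodType R) (nrm : V -> R) : Prop := {
  is_norm0_eq0 : forall x, nrm x = 0 -> x = 0;
  is_normZ : forall a x, nrm (a *: x) = `|a| * nrm x;
  is_normD : forall x y, nrm (x + y) <= nrm x + nrm y }.

(* x^(-p) for p > 0. [powR] sends 0 to 0 for every nonzero exponent, whereas
   here 0^(-p) = +oo. *)
Definition neg_powR (R : realType) (x p : R) : \bar R :=
  if x == 0 then +oo%E else (x `^ (- p))%:E.

Definition has_density dT (T : measurableType dT) (R : realType)
    (P mu : set T -> \bar R) (f : T -> R) : Prop :=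
  [/\ measurable_fun [set: T] f, (forall x, 0 <= f x) &
    forall A, measurable A -> P A = (\int[mu]_(x in A) (f x)%:E)%E].

Definition measure_support (R : realType) (T : topologicalType)
    (P : set T -> \bar R) : set T :=
  [set x | forall U, open U -> U x -> (0 < P U)%E].

Section quantization.
Context dT (T : measurableType dT) (R : realType) (rho : T -> T -> R).

Definition set_dist (x : T) (A : set T) : R := inf [set rho x a | a in A].

Definition distortion (p : R) (P : set T -> \bar R) (A : set T) : \bar R :=
  (\int[P]_x (set_dist x A `^ p)%:E)%E.

Definition optimal_quantizer (p : R) (P : set T -> \bar R) (n : nat)
    (A : set T) : Prop :=
  [/\ A !=set0, (A #<= `I_n)%card &
    forall B, B !=set0 -> (B #<= `I_n)%card ->
      (distortion p P A <= distortion p P B)%E].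

End quantization.

(* Main.v *)
Require Import Defs.
From mathcomp Require Import all_boot all_order all_algebra.
From mathcomp Require Import all_classical all_reals all_analysis.
From mathcomp Require Import measurable_realfun lra ring.
Set Implicit Arguments.
Unset Strict Implicit.
Unset Printing Implicit Defensive.
Import Order.TTheory GRing.Theory Num.Theory.
Import numFieldTopology.Exports numFieldNormedType.Exports.
Local Open Scope classical_set_scope.
Local Open Scope ring_scope.

(** Let [D x] be the distance from [x] to an optimal codebook of size at most
    [n], let [e] denote [n ^ (- 1 / d)], and let [V n] be the minimal value of
    the integral of [D ^ r]. The proof confronts two estimates of [V n - V n.+1].

    From below: adding a point [y] to the codebook lowers the distortion by a
    multiple of [D y ^ r] times the mass of the ball of radius [b * D y] around
    [y] ([distortion_add_point]).

    From above: [V n <= V n.+1 + K * e ^ (d + r)]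
    ([optimal_distortion_increment]). A grid whose mesh grows with the distance
    to the origin shows that [V n] is [O(e ^ r)] ([pierce]). Because [P] has a
    density, a codebook achieving this rate has a number of points in a fixed
    bounded region that is proportional to [n] ([count_points]), and by
    [packing] most of them have a neighbour at distance [O(e)]. Averaging over
    these points, one of them can be deleted at a cost of order
    [e ^ r / n = e ^ (d + r)] ([distortion_rem_point]).

    Together ([local_mass]): [D y ^ r * P (ball y (b * D y)) <= K * e ^ (d + r)]
    for every [y], which is exploited in two ways.
    - On a bounded set, the points where [D >= t] are covered by [O(t ^ - d)]
      cubes of side proportional to [t], each of mass
      [O(e ^ (d + r) * t ^ - r)]. The level set has therefore mass
      [O((e / t) ^ (d + r))], so that the moments of order [s < d + r] of [D / e]
      are bounded uniformly in [n] ([bounded_mismatch]). No lower bound on the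
      density enters there.
    - Far from the origin, monotonicity of the density gives [f (c x) <= f y]
      for all [y] in the ball, whose mass is then at least a multiple of
      [D x ^ d * f (c x)]. Hence [D x ^ s] is at most a multiple of
      [e ^ s * f (c x) ^ (- s / (d + r))], which is integrable by assumption.

    The argument is carried out in an abstract space with coordinates (record
    [chart]), of which the row vectors with a norm and the real line are
    instances. Scaling exponents are expressed through [e], called [rate]. *)

(** * Distances to finite sets *)

Lemma card_le_seq (T : choiceType) (A : set T) n : (A #<= `I_n)%card ->
  exists s : seq T, [/\ uniq s, (size s <= n)%N & A = [set` s]].
Proof.
move=> An; have finA : finite_set A by exact: card_le_finite An (finite_II n).
exists (finmap.enum_fset (fset_set A)); split; first exact: finmap.fset_uniq.
  by have := geq_card_fset_set An.
exact/esym/fset_setK.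
Qed.

Lemma seq_card_le (T : choiceType) (s : seq T) n : (size s <= n)%N ->
  ([set` s] #<= `I_n)%card.
Proof.
case: s => [|a s sn]; first by rewrite set_nil card_ge0.
have -> : [set` a :: s] = nth a (a :: s) @` `I_(size (a :: s)).
  apply/seteqP; split => [x /= xs|_ [i /= il <-]]; last exact: mem_nth.
  by exists (index x (a :: s)); [rewrite /mkset index_mem|rewrite nth_index].
by apply: card_le_trans (card_image_le _ _) _; rewrite card_le_II.
Qed.

Section set_dist_seq.
Context dT (T : measurableType dT) (R : realType) (rho : T -> T -> R).
Context (rho_ge0 : forall x y, 0 <= rho x y).

Lemma set_dist_le x A a : A a -> set_dist rho x A <= rho x a.
Proof.
move=> Aa; apply: ge_inf; last by exists a.
by exists 0 => _ [b _ <-].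
Qed.

Lemma set_dist_ge x A t : A !=set0 -> (forall a, A a -> t <= rho x a) ->
  t <= set_dist rho x A.
Proof.
move=> [a Aa] H; apply: lb_le_inf; first by exists (rho x a), a.
by move=> _ [b Ab <-]; exact: H.
Qed.

Lemma set_dist_ge0 x A : 0 <= set_dist rho x A.
Proof.
have [->|/set0P A0] := eqVneq A set0; last by apply: set_dist_ge.
by rewrite /set_dist image_set0 inf0.
Qed.

Lemma set_dist_set0 x : set_dist rho x set0 = 0.
Proof. by rewrite /set_dist image_set0 inf0. Qed.

Lemma set_dist1 x a : set_dist rho x [set a] = rho x a.
Proof. by rewrite /set_dist image_set1 inf1. Qed.

Lemma set_distU1 x a A : A !=set0 ->
  set_dist rho x (a |` A) = Num.min (rho x a) (set_dist rho x A).
Proof.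
move=> A0; apply/eqP; rewrite eq_le; apply/andP; split.
  rewrite le_min set_dist_le/=; last by left.
  by apply: set_dist_ge => // b Ab; apply: set_dist_le; right.
apply: set_dist_ge; first by exists a; left.
move=> b [->|Ab]; first by rewrite ge_min lexx.
by rewrite ge_min (@set_dist_le _ _ b)// orbT.
Qed.

Lemma set_seq_cons (a : T) s : [set` a :: s] = a |` [set` s].
Proof.
apply/seteqP; split => x /=; first by rewrite inE => /orP[/eqP|]; [left|right].
by move=> [->|]; rewrite inE ?eqxx// => ->; rewrite orbT.
Qed.

Lemma set_seq_nonempty (s : seq T) : s != [::] -> [set` s] !=set0.
Proof. by case: s => // a s _; exists a; rewrite /= inE eqxx. Qed.

Lemma set_dist_attained x (s : seq T) : s != [::] ->
  exists2 a, a \in s & set_dist rho x [set` s] = rho x a.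
Proof.
elim: s => // a [|b s] IH _.
  exists a; first by rewrite inE.
  by rewrite (_ : [set` _] = [set a]) ?set_dist1// set_seq_cons set_nil setU0.
have [//|c cs E] := IH; rewrite set_seq_cons set_distU1 ?E; last first.
  exact: set_seq_nonempty.
rewrite minEle; case: ifPn => _; first by exists a => //; rewrite inE eqxx.
by exists c => //; rewrite inE cs orbT.
Qed.

Lemma measurable_set_dist (s : seq T) :
  (forall a, measurable_fun setT (rho ^~ a)) ->
  measurable_fun setT (fun x => set_dist rho x [set` s]).
Proof.
move=> mrho; elim: s => [|a [|b s] IH].
- rewrite set_nil (_ : (fun x => _) = cst 0); first exact: measurable_cst.
  by apply/funext => x; rewrite set_dist_set0.
- rewrite (_ : [set` _] = [set a]); last by rewrite set_seq_cons set_nil setU0.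
  rewrite (_ : (fun x => _) = rho ^~ a); first exact: mrho.
  by apply/funext => x; rewrite set_dist1.
- rewrite set_seq_cons (_ : (fun x => _) =
    (fun x => Num.min (rho x a) (set_dist rho x [set` b :: s]))); last first.
    by apply/funext => x; rewrite set_distU1//; exact: set_seq_nonempty.
  exact: (measurable_minr (mrho a) IH).
Qed.

End set_dist_seq.

(** * Real powers and integrals *)

Section powers.
Context (R : realType).
Implicit Types p q u v x y : R.

Lemma le_powR p x y : 0 <= p -> 0 <= x -> x <= y -> x `^ p <= y `^ p.
Proof.
by move=> p0 x0 xy; apply: ge0_ler_powR => //; rewrite nnegrE// (le_trans x0).
Qed.

Lemma powR1E p : 1 `^ p = 1 :> R.
Proof. by rewrite powR1. Qed.

Lemma powRD_le p x y : 0 <= p -> 0 <= x -> 0 <= y ->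
  (x + y) `^ p <= 2 `^ p * (x `^ p + y `^ p).
Proof.
move=> p0; wlog xy : x y / x <= y => [W x0 y0|x0 y0].
  by case: (leP x y) => [|/ltW] xy; [|rewrite [x + y]addrC [X in _ * X]addrC];
    exact: W.
apply: le_trans (_ : (2 * y) `^ p <= _); first by apply: le_powR; lra.
by rewrite powRM// ler_pM2l ?powR_gt0// lerDr powR_ge0.
Qed.

Lemma powR_le_root p x y : 0 < p -> 0 <= x -> x `^ p <= y -> x <= y `^ p^-1.
Proof.
move=> p0 x0 xy.
have -> : x = (x `^ p) `^ p^-1 by rewrite -powRrM divff ?gt_eqF// powRr1.
by rewrite le_powR ?powR_ge0// invr_ge0 ltW.
Qed.

(** Convexity of [x ^ (- q)]: this is [ln (v / u) <= v / u - 1] inside [expR]. *)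
Lemma powRN_tangent q u v : 0 <= q -> 0 < u -> 0 < v ->
  u `^ (- q) - v `^ (- q) <= q * u `^ (- q - 1) * (v - u).
Proof.
move=> q0 u0 v0.
have -> : v `^ (- q) = u `^ (- q) * expR (- q * ln (v / u)).
  rewrite /powR !gt_eqF// -expRD ln_div ?posrE//; congr expR; ring.
have -> : u `^ (- q - 1) = u `^ (- q) / u.
  rewrite powRD ?(gt_eqF u0) ?implybT// powR_inv1 ?ltW//.
have lnvu : ln (v / u) <= v / u - 1.
  have := @le_ln1Dx R (v / u - 1); rewrite subrKC; apply.
  by rewrite ltrBDl addrN divr_gt0.
rewrite -subr_ge0; set w := u `^ _; have w0 : 0 <= w by exact: powR_ge0.
have E := expR_ge1Dx (- q * ln (v / u)).
have -> : q * (w / u) * (v - u) = w * (q * (v / u - 1)).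
  by field; rewrite gt_eqF.
have {}E : 1 - q * (v / u - 1) <= expR (- q * ln (v / u)).
  apply: le_trans E; rewrite mulNr lerD2l lerN2; exact: ler_wpM2l.
set z := expR _ in E *.
have -> : w * (q * (v / u - 1)) - (w - w * z) =
   w * (z - (1 - q * (v / u - 1))) by ring.
by rewrite mulr_ge0// subr_ge0.
Qed.

Lemma powRV x p : 0 <= x -> x^-1 `^ p = (x `^ p)^-1.
Proof.
by move=> x0; rewrite -[x^-1]powR_inv1// powRAC powR_inv1 ?powR_ge0.
Qed.

Lemma powRXn x p n : 0 <= x -> (x ^+ n) `^ p = (x `^ p) ^+ n.
Proof.
move=> x0; elim: n => [|n IH]; first by rewrite !expr0 powR1E.
by rewrite !exprS powRM ?exprn_ge0// IH.
Qed.

End powers.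

Lemma ge0_le_fin_num (R : realDomainType) (x : \bar R) (V : R) :
  (0 <= x)%E -> (x <= V%:E)%E -> x \is a fin_num.
Proof. by move=> x0 xV; rewrite ge0_fin_numE// (le_lt_trans xV)// ltry. Qed.

Lemma le_fine_addr (R : realDomainType) (x v : \bar R) (y : R) :
  x \is a fin_num -> v \is a fin_num -> fine x <= fine v + y ->
  (x <= v + y%:E)%E.
Proof. by move: x v => [x| |] [v| |]//= _ _; rewrite lee_fin. Qed.

Section integral_comparison.
Context dT (T : measurableType dT) (R : realType).
Context (mu : {measure set T -> \bar R}).
Implicit Types f g h : T -> \bar R.
Local Open Scope ereal_scope.

Lemma integral_le_addM f g h (c : R) : (0 <= c)%R ->
  measurable_fun setT f -> measurable_fun setT g -> measurable_fun setT h ->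
  (forall x, 0 <= f x) -> (forall x, 0 <= g x) -> (forall x, 0 <= h x) ->
  {ae mu, forall x, f x <= g x + c%:E * h x} ->
  \int[mu]_x f x <= \int[mu]_x g x + c%:E * \int[mu]_x h x.
Proof.
move=> c0 mf mg mh f0 g0 h0 fgh; have c0E : 0 <= c%:E by rewrite lee_fin.
rewrite -ge0_integralZl_EFin// -ge0_integralD//; last 2 first.
- by move=> x _; rewrite mule_ge0.
- exact: measurable_funeM.
apply: ae_ge0_le_integral => //.
- by move=> x _; rewrite adde_ge0// mule_ge0.
- by apply: emeasurable_funD => //; exact: measurable_funeM.
- by apply: filterS fgh => x + _.
Qed.

Lemma integral_ge_addM f g h (c : R) : (0 <= c)%R ->
  measurable_fun setT f -> measurable_fun setT g -> measurable_fun setT h ->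
  (forall x, 0 <= g x) -> (forall x, 0 <= h x) ->
  (forall x, g x + c%:E * h x <= f x) ->
  \int[mu]_x g x + c%:E * \int[mu]_x h x <= \int[mu]_x f x.
Proof.
move=> c0 mf mg mh g0 h0 fgh; have c0E : 0 <= c%:E by rewrite lee_fin.
rewrite -ge0_integralZl_EFin// -ge0_integralD//; last 2 first.
- by move=> x _; rewrite mule_ge0.
- exact: measurable_funeM.
apply: ge0_le_integral => //.
- by move=> x _; rewrite adde_ge0// mule_ge0.
- by apply: emeasurable_funD => //; exact: measurable_funeM.
Qed.

End integral_comparison.

Lemma integral_cst_probability dT (T : measurableType dT) (R : realType)
  (P : probability T R) (c : \bar R) : (\int[P]_x (cst c) x = c)%E.
Proof.
by rewrite integral_cst// [X in (_ * X)%E](@probability_setT _ _ _ P) mule1.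
Qed.

(** * Coordinate charts and product grids *)

(** Abstracts what the proof uses of a normed space: coordinates [crd] filling
    the whole of [R ^ d] ([mkp] builds a point from its coordinates), a measure
    giving cubes their volume, and a pseudometric [rho] equivalent to the
    distance of the supremum norm. A single constant [a] serves for both
    directions of the equivalence. *)
Record chart (R : realType) (d : nat) dT (T : measurableType dT)
    (mu : set T -> \bar R) (rho : T -> T -> R) (crd : T -> 'I_d -> R)
    (mkp : ('I_d -> R) -> T) (a : R) : Prop := Chart {
  chart_dim : (0 < d)%N;
  chart_const : 0 < a;
  chart_mkpK : forall v i, crd (mkp v) i = v i;
  chart_measurable_crd : forall i, measurable_fun [set: T] (crd ^~ i);
  chart_box : forall v t, 0 <= t ->
    mu [set x | forall i, `|crd x i - v i| <= t] = ((2 * t) ^+ d)%:E;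
  chart_measurable_rho : forall b, measurable_fun [set: T] (rho ^~ b);
  chart_rho_ge0 : forall x y, 0 <= rho x y;
  chart_rho_sym : forall x y, rho x y = rho y x;
  chart_rho_triangle : forall x y z, rho x z <= rho x y + rho y z;
  chart_rho_le : forall x y t, (forall i, `|crd x i - crd y i| <= t) ->
    rho x y <= a * t;
  chart_crd_le : forall x y i, `|crd x i - crd y i| <= a * rho x y }.

Section grid.
Context (R : realType) (d : nat) dT (T : measurableType dT)
  (mu : {measure set T -> \bar R}) (rho : T -> T -> R) (crd : T -> 'I_d -> R)
  (mkp : ('I_d -> R) -> T) (a : R).
Context (C : chart mu rho crd mkp a).

Definition box (L : R) : set T := [set x | forall i, `|crd x i| <= L].

Definition open_cube (v : 'I_d -> R) (h : R) : set T :=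
  [set x | forall i, `|crd x i - v i| < h].

Definition closed_cube (v : 'I_d -> R) (h : R) : set T :=
  [set x | forall i, `|crd x i - v i| <= h].

Lemma measurable_crd_set (P : 'I_d -> R -> bool) :
  (forall i, measurable_fun setT (P i)) ->
  measurable [set x : T | forall i, P i (crd x i)].
Proof.
move=> mP; rewrite (_ : [set _ | _] =
    \bigcap_(i in [set: 'I_d]) ((fun x => P i (crd x i)) @^-1` [set true])).
  apply: fin_bigcap_measurable => // i _; rewrite -[X in measurable X]setTI.
  have mPi : measurable_fun setT (fun x => P i (crd x i)).
    by apply: (measurableT_comp (mP i)); exact: chart_measurable_crd C i.
  exact: mPi.
by apply/seteqP; split => x /= H i; [move=> _; exact: H|exact: H i I].
Qed.

Lemma measurable_box L : measurable (box L).
Proof.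
apply: (@measurable_crd_set (fun _ t => `|t| <= L)) => i.
by apply: measurable_fun_ler => //; exact: measurableT_comp.
Qed.

Lemma measurable_open_cube v h : measurable (open_cube v h).
Proof.
apply: (@measurable_crd_set (fun i t => `|t - v i| < h)) => i.
apply: measurable_fun_ltr => //; apply: measurableT_comp => //.
exact: measurable_funB.
Qed.

Lemma measurable_closed_cube v h : measurable (closed_cube v h).
Proof.
apply: (@measurable_crd_set (fun i t => `|t - v i| <= h)) => i.
apply: measurable_fun_ler => //; apply: measurableT_comp => //.
exact: measurable_funB.
Qed.

Section cells.
Context (L h : R) (L0 : 0 <= L) (h0 : 0 < h).

Let M := (Num.truncn (2 * L / h)).+1.

Definition cell (x : T) : {ffun 'I_d -> 'I_M} :=
  [ffun i => inord (Num.truncn ((crd x i + L) / h))].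

Lemma cell_close x y i : box L x -> box L y -> cell x = cell y ->
  `|crd x i - crd y i| < h.
Proof.
move=> bx byy /ffunP/(_ i); rewrite !ffunE => /(congr1 val) /=.
have K z : box L z -> 0 <= (crd z i + L) / h /\
    (Num.truncn ((crd z i + L) / h) < M)%N.
  move=> /(_ i); rewrite ler_norml => /andP[z1 z2].
  split; first by rewrite divr_ge0// ?(ltW h0)//; lra.
  by rewrite ltnS le_truncn// ler_wpM2r ?invr_ge0 ?(ltW h0)//; lra.
have [x0 xM] := K _ bx; have [y0 yM] := K _ byy.
rewrite !inordK// => E.
have /andP[x1 x2] := truncn_itv x0; have /andP[y1 y2] := truncn_itv y0.
rewrite E -(natr1 _) in x1 x2; rewrite -natr1 in y2.
have -> : crd x i - crd y i = h * ((crd x i + L) / h - (crd y i + L) / h).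
  by field; rewrite gt_eqF.
rewrite normrM (gtr0_norm h0) -[ltRHS]mulr1 ltr_pM2l// ltr_norml.
apply/andP; split; lra.
Qed.

Lemma card_cells : (#|{ffun 'I_d -> 'I_M}|%:R : R) <= (2 * L / h + 1) ^+ d.
Proof.
have L2 : 0 <= 2 * L / h by rewrite divr_ge0 ?mulr_ge0// ltW.
rewrite card_ffun !card_ord natrX lerXn2r// ?nnegrE ?addr_ge0//.
by rewrite /M -natr1 lerD2r; have /andP[] := truncn_itv L2.
Qed.

(** Points of the box lying in one cell of the grid of mesh [h] are close to each
    other, so that the points of [s] occupy distinct cells. *)
Lemma packing (s : seq T) : uniq s -> (forall x, x \in s -> box L x) ->
  (forall x y, x \in s -> y \in s -> x != y ->
    ~ forall i, `|crd x i - crd y i| < h) ->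
  (size s)%:R <= (2 * L / h + 1) ^+ d.
Proof.
move=> us sL sh; apply: le_trans card_cells; rewrite ler_nat.
rewrite -(size_map cell).
have /card_uniqP <- : uniq (map cell s).
  rewrite map_inj_in_uniq// => x y xs ys xy; apply/eqP; apply/negPn/negP => nxy.
  by apply: (sh x y) => // i; apply: cell_close => //; exact: sL.
exact: max_card.
Qed.

(** Each cell that meets [A] is contained in the cube of half-side [h] centered
    at any point of [A] in that cell. *)
Lemma covering (nu : {measure set T -> \bar R}) (A : set T) (p : R) :
  measurable A -> A `<=` box L -> 0 <= p ->
  (forall x, A x ->
    (nu (open_cube (crd x) h) <= p%:E)%E) ->
  (nu A <= ((2 * L / h + 1) ^+ d * p)%:E)%E.
Proof.
move=> mA AL p0 Ap.
have /choice[F HF] : forall k : {ffun 'I_d -> 'I_M}, exists B : set T,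
    [/\ measurable B, (nu B <= p%:E)%E & A `&` cell @^-1` [set k] `<=` B].
  move=> k; have [[x [Ax xk]]|N] := pselect (exists x, A x /\ cell x = k).
    exists (open_cube (crd x) h); split.
    - exact: measurable_open_cube.
    - exact: Ap.
    - by move=> y [Ay /= yk] i; apply: cell_close;
        [exact: AL|exact: AL|rewrite xk].
  exists set0; split; [by []|by rewrite measure0 lee_fin|].
  by move=> y [Ay yk]; apply: N; exists y.
have := @content_sub_fsum _ _ _ nu _ [set: {ffun 'I_d -> 'I_M}] A F.
move=> /(_ finite_finset) H; apply: le_trans (H _ mA _) _.
- by move=> k _; have [] := HF k.
- by move=> x Ax; exists (cell x) => //; have [_ _] := HF (cell x); apply; split.
rewrite (fsbig_finite _ _ finite_finset) /=.
apply: (@le_trans _ _ (\sum_(k <- finmap.enum_fset (fset_set [set: {ffun 'I_d -> 'I_M}])) p%:E)%E).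
  by apply: lee_sum => k _; have [] := HF k.
rewrite sumEFin lee_fin big_const_seq count_predT iter_addr_0 -[leLHS]mulr_natl.
apply: ler_wpM2r => //; apply: le_trans card_cells; rewrite ler_nat.
rewrite cardE; apply: uniq_leq_size; first exact: finmap.fset_uniq.
by move=> k _; rewrite mem_enum.
Qed.

End cells.
End grid.

(** * Upper bound for the optimal distortion *)

(** The order of magnitude of the distance to a codebook of size [n] that is
    well spread over a bounded set. *)
Definition rate (R : realType) (d n : nat) : R := n%:R `^ (- d%:R^-1).

Section rate.
Context (R : realType) (d : nat) (d_gt0 : (0 < d)%N).

Lemma rate_gt0 n : (0 < n)%N -> 0 < rate R d n.
Proof. by move=> n0; rewrite powR_gt0// ltr0n. Qed.

Lemma rate_le1 n : (0 < n)%N -> rate R d n <= 1.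
Proof.
move=> n0; rewrite /rate powRN invf_le1 ?powR_gt0 ?ltr0n//.
by rewrite -[leLHS](powRr0 n%:R) ler_powR ?ler1n// invr_ge0.
Qed.

Lemma rateX n : (0 < n)%N -> rate R d n ^+ d = n%:R^-1.
Proof.
move=> n0; rewrite -powR_mulrn ?powR_ge0// /rate -powRrM mulNr mulVf.
  by rewrite powR_inv1.
by rewrite pnatr_eq0 -lt0n.
Qed.

End rate.

Section compander.
Context (R : realType) (e : R) (e0 : 0 < e).

(** Image of the uniform grid of [(0, 1]] under the inverse of
    [t |-> (1 + t) ^ (- e)]: its mesh around [t] is of order
    [(1 + t) ^ (1 + e) / m], so that [m] points suffice on the whole half-line at
    the price of slightly more than one moment. *)
Definition compander (m j : nat) : R := (j.+1%:R / m%:R) `^ (- e^-1) - 1.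

Lemma compander_ge0_approx m (t : R) : (0 < m)%N -> 0 <= t -> exists j : 'I_m,
  `|t - compander m j| <= e^-1 * (1 + t) `^ (1 + e) / m%:R.
Proof.
move=> m0 t0; pose u := (1 + t) `^ (- e).
have mR : 0 < m%:R :> R by rewrite ltr0n.
have t1 : 0 < 1 + t by lra.
have u0 : 0 < u by rewrite powR_gt0.
have u1 : u <= 1.
  rewrite /u powRN invf_le1 ?powR_gt0// -[leLHS](powRr0 (1 + t)).
  by rewrite ler_powR ?(ltW e0)//; lra.
have [j [uv vu]] : exists j : 'I_m,
    u <= j.+1%:R / m%:R /\ j.+1%:R / m%:R <= u + m%:R^-1.
  have um0 : 0 <= u * m%:R by rewrite mulr_ge0 ?ltW.
  have /andP[um1 um2] := truncn_itv um0.
  have [Hlt|Hge] := ltnP (Num.truncn (u * m%:R)) m.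
    exists (Ordinal Hlt) => /=; split; first by rewrite ler_pdivlMr// ltW.
    by rewrite ler_pdivrMr// mulrDl mulVf ?gt_eqF// -natr1 lerD2r.
  have um : u = 1.
    apply/eqP; rewrite eq_le u1/= -(ler_pM2r mR) mul1r.
    by apply: le_trans um1; rewrite ler_nat.
  have pm : (m.-1 < m)%N by rewrite prednK.
  (* Only for t = 0, where u = 1 is the last grid point. *)
  exists (Ordinal pm) => /=; rewrite prednK// divff ?gt_eqF// um; split => //.
  by rewrite lerDl invr_ge0 ltW.
exists j; rewrite /compander; set v := _ / _ in uv vu *.
have v0 : 0 < v by rewrite divr_gt0// ltr0n.
have tu : 1 + t = u `^ (- e^-1).
  by rewrite /u -powRrM mulrNN divff ?gt_eqF// powRr1// ltW.
have -> : t - (v `^ (- e^-1) - 1) = u `^ (- e^-1) - v `^ (- e^-1).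
  by rewrite -tu; ring.
have -> : (1 + t) `^ (1 + e) = u `^ (- e^-1 - 1).
  rewrite /u -powRrM; congr powR; rewrite mulrBr mulrNN divff ?gt_eqF//; ring.
have ei0 : 0 <= e^-1 by rewrite invr_ge0 ltW.
rewrite ger0_norm.
  apply: le_trans (powRN_tangent ei0 u0 v0) _.
  by rewrite ler_wpM2l ?mulr_ge0 ?powR_ge0// lerBlDl.
rewrite subr_ge0 !powRN lef_pV2 ?posrE ?powR_gt0//.
by rewrite le_powR// ltW.
Qed.

Lemma compander_approx m (t : R) : (0 < m)%N -> exists v : bool * 'I_m,
  `|t - (-1) ^+ v.1 * compander m v.2| <=
    e^-1 * (1 + `|t|) `^ (1 + e) / m%:R.
Proof.
move=> m0; have [j Hj] := compander_ge0_approx m0 (normr_ge0 t).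
have [t0|t0] := leP 0 t.
  exists (false, j); rewrite expr0 mul1r.
  by move: Hj; rewrite (ger0_norm t0).
exists (true, j); rewrite expr1 mulN1r opprK.
move: Hj; rewrite (ltr0_norm t0).
by rewrite -[X in X <= _]normrN opprB opprK [t + _]addrC.
Qed.

End compander.

Section pierce.
Context (R : realType) (d : nat) dT (T : measurableType dT)
  (mu : {measure set T -> \bar R}) (rho : T -> T -> R) (crd : T -> 'I_d -> R)
  (mkp : ('I_d -> R) -> T) (a : R).
Context (C : chart mu rho crd mkp a).
Context (P : probability T R) (r delta : R).
Context (r0 : 0 < r) (delta0 : 0 < delta).

Local Notation o := (mkp (fun=> 0)).

Context (moment : (\int[P]_x (rho x o `^ (r + delta))%:E < +oo)%E).

Let d_gt0 := chart_dim C.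
Let a0 := chart_const C.
Let rho_ge0 := chart_rho_ge0 C.

Lemma crd_le_rho x i : `|crd x i| <= a * rho x o.
Proof. by have := chart_crd_le C x o i; rewrite (chart_mkpK C) subr0. Qed.

Lemma measurable_dist_pow (s : seq T) (p : R) :
  measurable_fun setT (fun x => (set_dist rho x [set` s] `^ p)%:E).
Proof.
apply/measurable_EFinP.
have m : measurable_fun setT (fun x => set_dist rho x [set` s]).
  by apply: measurable_set_dist => //; exact: chart_measurable_rho C.
exact: (measurableT_comp (measurable_powR p) m).
Qed.

Lemma measurable_rho_pow (y : T) (p : R) :
  measurable_fun setT (fun x => (rho x y `^ p)%:E).
Proof.
apply/measurable_EFinP.
exact: (measurableT_comp (measurable_powR p) (chart_measurable_rho C y)).
Qed.

Lemma measurable_dist_ge (s : seq T) (t : R) :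
  measurable [set x | t <= set_dist rho x [set` s]].
Proof.
have mb : measurable_fun setT (fun x => t <= set_dist rho x [set` s]).
  apply: measurable_fun_ler => //; apply: measurable_set_dist => //.
  exact: chart_measurable_rho C.
rewrite (_ : [set x | _] = (fun x => t <= set_dist rho x [set` s]) @^-1` [set true])//.
by rewrite -[X in measurable X]setTI; exact: mb.
Qed.

Let p := r + delta.
Let p0 : 0 < p. Proof. by rewrite addr_gt0. Qed.

Lemma distortion_le_moment : exists2 E : R, 0 <= E &
  forall (s : seq T) (c : R), 0 <= c ->
    (forall x, set_dist rho x [set` s] `^ r <= c * (1 + rho x o `^ p)) ->
    (distortion rho r P [set` s] <= (c * E)%:E)%E.
Proof.
have I0 : (0 <= \int[P]_x (rho x o `^ p)%:E)%E.
  by apply: integral_ge0 => x _; rewrite lee_fin powR_ge0.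
have If : (\int[P]_x (rho x o `^ p)%:E)%E \is a fin_num.
  by rewrite ge0_fin_numE.
exists (1 + fine (\int[P]_x (rho x o `^ p)%:E)%E); first by rewrite addr_ge0// fine_ge0.
move=> s c c0 H.
apply: le_trans (@integral_le_addM _ _ _ P
  (fun x => (set_dist rho x [set` s] `^ r)%:E) (cst c%:E)
  (fun x => (rho x o `^ p)%:E) c c0 _ _ _ _ _ _ _) _.
- exact: measurable_dist_pow.
- exact: measurable_cst.
- exact: measurable_rho_pow.
- by move=> x; rewrite lee_fin powR_ge0.
- by move=> x; rewrite lee_fin.
- by move=> x; rewrite lee_fin powR_ge0.
- by apply/aeW => x; rewrite /= -EFinM -EFinD lee_fin (le_trans (H x))// mulrDr mulr1.
rewrite integral_cst_probability.
by rewrite -{1}(fineK If) -EFinM -EFinD lee_fin mulrDr mulr1.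
Qed.

Definition pierce_grid (m : nat) : seq T :=
  [seq mkp (fun i => (-1) ^+ (v i).1 * compander (delta / r) m (v i).2)
    | v : {ffun 'I_d -> bool * 'I_m}].

Lemma size_pierce_grid m : size (pierce_grid m) = ((2 * m) ^ d)%N.
Proof. by rewrite size_map -cardE card_ffun card_prod card_bool !card_ord. Qed.

Lemma pierce_grid_dist m x : (0 < m)%N ->
  set_dist rho x [set` pierce_grid m] <=
    a * ((delta / r)^-1 * (1 + a * rho x o) `^ (1 + delta / r) / m%:R).
Proof.
move=> m0; have e0 : 0 < delta / r by rewrite divr_gt0.
have /choice[v Hv] : forall i, exists v : bool * 'I_m,
    `|crd x i - (-1) ^+ v.1 * compander (delta / r) m v.2| <=
    (delta / r)^-1 * (1 + `|crd x i|) `^ (1 + delta / r) / m%:R.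
  by move=> i; exact: compander_approx.
pose w := [ffun i => v i].
pose y := mkp (fun i => (-1) ^+ (w i).1 * compander (delta / r) m (w i).2).
apply: le_trans (set_dist_le rho_ge0 x (_ : [set` pierce_grid m] y)) _.
  by rewrite /=; apply/mapP; exists w; rewrite ?mem_enum.
apply: (chart_rho_le C) => i; rewrite (chart_mkpK C) ffunE.
apply: le_trans (Hv i) _; rewrite ler_wpM2r ?invr_ge0//.
rewrite ler_wpM2l ?invr_ge0 ?(ltW e0)// le_powR ?addr_ge0 ?(ltW e0)//.
by rewrite lerD2l crd_le_rho.
Qed.

(** Pierce's lemma. The companding grid with [e = delta / r] makes the error to
    the power [r] of order [(1 + |x|) ^ (r + delta)] times [m ^ (- r)], where [m]
    is half the number of grid values per coordinate. *)
Lemma pierce : exists2 K : R, 0 <= K & forall n, (0 < n)%N ->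
  exists s : seq T, [/\ s != [::], (size s <= n)%N &
    (distortion rho r P [set` s] <= (K * rate R d n `^ r)%:E)%E].
Proof.
have [E E0 HE] := distortion_le_moment.
pose q := (delta / r)^-1.
have q0 : 0 < q by rewrite invr_gt0 divr_gt0.
pose K1 := (a * q) `^ r * (2 `^ p * (1 + a `^ p)).
have K10 : 0 <= K1.
  by rewrite /K1 !mulr_ge0 ?addr_ge0 ?powR_ge0.
exists ((K1 * 4 `^ r + 2 `^ r) * E).
  by rewrite !(mulr_ge0, addr_ge0, powR_ge0).
move=> n n0; set z := rate R d n.
have z0 : 0 < z by exact: rate_gt0.
have zr : 0 < z `^ r by rewrite powR_gt0.
(* For n <= 2 ^ d a single point is enough. *)
have [z2|z2] := leP (1 / 2) z.
  exists [:: o]; split => //=.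
  apply: le_trans (HE _ 1 _ _) _ => // [x|].
    rewrite (_ : [set` _] = [set o]); last first.
      by rewrite set_seq_cons set_nil setU0.
    rewrite set_dist1 mul1r; have [x1|x1] := leP (rho x o) 1.
      apply: (@le_trans _ _ 1); last by rewrite lerDl powR_ge0.
      by rewrite -[leRHS](powR1E r) le_powR// ltW.
    apply: (@le_trans _ _ (rho x o `^ p)); last by rewrite lerDr.
    by rewrite ler_powR ?(ltW x1)// /p lerDl ltW.
  rewrite lee_fin mul1r mulrAC ler_peMl//.
  rewrite mulrDl; apply: (@le_trans _ _ (2 `^ r * z `^ r)); last first.
    by rewrite lerDr mulr_ge0 ?powR_ge0// mulr_ge0 ?powR_ge0.
  rewrite -powRM ?(ltW z0)// -[leLHS](powR1E r).
  rewrite le_powR ?(ltW r0)//; lra.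
have z2' : 2 <= z^-1 by rewrite -[2]invrK lef_pV2 ?posrE//; lra.
pose m := Num.truncn (z^-1 / 2).
have hz0 : 0 <= z^-1 / 2 by lra.
have /andP[m1 m2] := truncn_itv hz0; rewrite -/m in m1 m2.
have m0 : (0 < m)%N by rewrite truncn_gt0; lra.
have mR : 1 <= m%:R :> R by rewrite ler1n.
rewrite -[m.+1%:R]natr1 in m2.
exists (pierce_grid m); split.
- by rewrite -size_eq0 size_pierce_grid -lt0n expn_gt0 muln_gt0 m0.
- rewrite size_pierce_grid -(ler_nat R) natrX natrM.
  have -> : n%:R = z^-1 ^+ d by rewrite exprVn rateX// invrK.
  by rewrite lerXn2r// ?nnegrE ?invr_ge0 ?(ltW z0)//; lra.
apply: le_trans (HE _ (K1 * m%:R^-1 `^ r) _ _) _.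
- by rewrite mulr_ge0 ?powR_ge0.
- move=> x; apply: le_trans (le_powR _ _ (pierce_grid_dist x m0)) _.
  + exact: ltW.
  + exact: set_dist_ge0.
  have ar : 0 <= a * rho x o by rewrite mulr_ge0// ltW.
  rewrite -/q.
  have -> : a * (q * (1 + a * rho x o) `^ (1 + delta / r) / m%:R) =
    (a * q) * (1 + a * rho x o) `^ (1 + delta / r) * m%:R^-1 by ring.
  rewrite powRM ?mulr_ge0 ?powR_ge0 ?(ltW a0) ?(ltW q0) ?invr_ge0//.
  rewrite [leRHS]mulrAC ler_wpM2r ?powR_ge0//.
  rewrite powRM ?mulr_ge0 ?powR_ge0 ?(ltW a0) ?(ltW q0)//.
  rewrite -powRrM mulrDl mul1r divfK ?gt_eqF// -/p /K1 -!mulrA.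
  rewrite ler_wpM2l ?powR_ge0//.
  apply: le_trans (powRD_le _ _ _) _ => //; first exact: ltW.
  rewrite ler_wpM2l ?powR_ge0// powR1 powRM ?(ltW a0)//.
  set A := a `^ p; set B := rho x o `^ p.
  have A0 : 0 <= A by exact: powR_ge0.
  have B0 : 0 <= B by exact: powR_ge0.
  have -> : (1 + A) * (1 + B) = 1 + A * B + (A + B) by ring.
  by rewrite lerDl addr_ge0.
rewrite lee_fin [leRHS]mulrAC ler_wpM2r//.
rewrite mulrDl -[leLHS]addr0 lerD ?mulr_ge0 ?powR_ge0//.
rewrite -[leRHS]mulrA ler_wpM2l// -powRM ?(ltW z0)// le_powR ?(ltW r0) ?invr_ge0//.
by rewrite -[4 * z]invrK lef_pV2 ?posrE ?invr_gt0 ?mulr_gt0// ?ltr0n// invfM; lra.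
Qed.

End pierce.

(** * Increments of the optimal distortion *)

Section increments.
Context (R : realType) (d : nat) dT (T : measurableType dT)
  (mu : {measure set T -> \bar R}) (rho : T -> T -> R) (crd : T -> 'I_d -> R)
  (mkp : ('I_d -> R) -> T) (a : R).
Context (C : chart mu rho crd mkp a).
Context (P : probability T R) (r : R) (r0 : 0 < r).

Let d_gt0 := chart_dim C.
Let a0 := chart_const C.
Let rho_ge0 := chart_rho_ge0 C.

Local Notation dist x s := (set_dist rho x [set` s]).
Local Notation distort s := (distortion rho r P [set` s]).

Lemma dist_le_mem x (s : seq T) b : b \in s -> dist x s <= rho x b.
Proof. by move=> bs; exact: set_dist_le. Qed.

Lemma dist_ge0 x (s : seq T) : 0 <= dist x s.
Proof. exact: set_dist_ge0. Qed.

Lemma dist_triangle x y (s : seq T) : s != [::] -> dist x s <= rho x y + dist y s.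
Proof.
move=> s0; have [b bs ->] := set_dist_attained rho_ge0 y s0.
apply: le_trans (dist_le_mem x bs) _.
exact: (chart_rho_triangle C x y b).
Qed.

Lemma distortion_ge0 (s : seq T) : (0 <= distort s)%E.
Proof. by apply: integral_ge0 => x _; rewrite lee_fin powR_ge0. Qed.

Lemma measurable_ball_rho y t : measurable [set x | rho x y <= t].
Proof.
have mb : measurable_fun setT (fun x => rho x y <= t).
  by apply: measurable_fun_ler => //; exact: chart_measurable_rho C y.
rewrite (_ : [set x | _] = (fun x => rho x y <= t) @^-1` [set true])//.
by rewrite -[X in measurable X]setTI; exact: mb.
Qed.

Lemma distortion_ge_mass (s : seq T) t A : measurable A -> 0 <= t ->
  (forall x, A x -> t <= dist x s) -> ((t `^ r)%:E * P A <= distort s)%E.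
Proof.
move=> mA t0 At.
have <- : (\int[P]_x (\1_A x)%:E = P A)%E by rewrite integral_indic// setIT.
have := @integral_ge_addM _ _ _ P (fun x => (dist x s `^ r)%:E)
  (cst 0%E) (fun x => (\1_A x)%:E) (t `^ r).
rewrite integral0 add0e; apply.
- exact: powR_ge0.
- exact: measurable_dist_pow C _ _.
- exact: measurable_cst.
- exact/measurable_EFinP/measurable_indic.
- by [].
- by move=> x; rewrite lee_fin.
- move=> x; rewrite /= add0e -EFinM lee_fin indicE.
  have [|_] := boolP (x \in A); last by rewrite mulr0 powR_ge0.
  by rewrite inE => /At xt; rewrite mulr1 le_powR ?(ltW r0).
Qed.

(** On the ball of radius [b * D] around [y], where [D] is the distance from [y]
    to the codebook, the distance drops from at least [3 / 4 * D] to at most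
    [1 / 4 * D]. *)
Lemma distortion_add_point (s : seq T) (y : T) (b : R) :
  s != [::] -> 0 <= b -> b <= 4^-1 ->
  (distort (y :: s) + (((3 / 4) `^ r - (1 / 4) `^ r) * dist y s `^ r)%:E
     * P [set x | (rho x y <= b * dist y s)%R] <= distort s)%E.
Proof.
move=> s0 b0 b4; set D := dist y s; set B := (X in (P X)%E).
have D0 : 0 <= D by exact: dist_ge0.
have mB : measurable B by exact: measurable_ball_rho.
have q1 : 0 <= 1 / 4 :> R by lra.
have q3 : 0 <= 3 / 4 :> R by lra.
have k0 : 0 <= (3 / 4) `^ r - (1 / 4) `^ r.
  by rewrite subr_ge0 le_powR// ?(ltW r0)//; lra.
have <- : (\int[P]_x (\1_B x)%:E = P B)%E by rewrite integral_indic// setIT.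
apply: (@integral_ge_addM _ _ _ P (fun x => (dist x s `^ r)%:E)
  (fun x => (dist x (y :: s) `^ r)%:E) (fun x => (\1_B x)%:E)
  (((3 / 4) `^ r - (1 / 4) `^ r) * D `^ r)).
- by rewrite mulr_ge0 ?powR_ge0.
- exact: measurable_dist_pow C _ _.
- exact: measurable_dist_pow C _ _.
- exact/measurable_EFinP/measurable_indic.
- by move=> x; rewrite lee_fin powR_ge0.
- by move=> x; rewrite lee_fin.
- move=> x; rewrite -EFinM -EFinD lee_fin indicE.
  have [|xB] := boolP (x \in B); last first.
    rewrite mulr0 addr0 le_powR ?(ltW r0) ?dist_ge0//.
    have [c cs ->] := set_dist_attained rho_ge0 x s0.
    by apply: dist_le_mem; rewrite inE cs orbT.
  rewrite inE /B /= => xB; rewrite mulr1.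
  have xD : rho x y <= 1 / 4 * D by apply: le_trans xB _; rewrite ler_wpM2r//; lra.
  apply: (@le_trans _ _ ((1 / 4) `^ r * D `^ r +
     ((3 / 4) `^ r - (1 / 4) `^ r) * D `^ r)).
    rewrite lerD2r -powRM// le_powR ?(ltW r0) ?dist_ge0//.
    by apply: le_trans xD; apply: dist_le_mem; rewrite inE eqxx.
  rewrite -mulrDl subrKC -powRM// le_powR ?(ltW r0) ?mulr_ge0//.
  have := dist_triangle y x s0; rewrite -/D (chart_rho_sym C); lra.
Qed.

Lemma dist_rem_le x (s : seq T) b : b \in s -> rem b s != [::] ->
  dist x (rem b s) <= rho x b -> dist x (rem b s) <= dist x s.
Proof.
move=> bs rs0 H.
have s0 : s != [::] by apply: contraTneq bs => ->.
have [c cs E] := set_dist_attained rho_ge0 x s0; rewrite E.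
have [->//|cb] := eqVneq c b; apply: dist_le_mem.
by rewrite (perm_mem (perm_to_rem bs)) inE (negbTE cb) in cs.
Qed.

(** Deleting [b] only affects its open Voronoi cell, where the distance grows by
    at most [eta] because [b] has a neighbour at distance [eta]. These cells are
    disjoint, hence the total cost of the deletions of the points of [S], one at
    a time, is at most that of a single global change. Stated for a lower bound
    [X] of the resulting distortions, which saves choosing the point. *)
Lemma distortion_rem_point (s S : seq T) (eta V X : R) :
  uniq s -> uniq S -> {subset S <= s} -> 0 <= eta ->
  (forall b, b \in S -> exists c, [/\ c \in s, c != b & rho b c <= eta]) ->
  (distort s <= V%:E)%E ->
  (forall b, b \in S -> (X%:E <= distort (rem b s))%E) ->
  (size S)%:R * X <= (size S)%:R * V + 2 `^ r * (V + eta `^ r).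
Proof.
move=> us uS Ss eta0 nbr sV HX.
pose k : R := (size S)%:R.
have k0 : 0 <= k by rewrite ler0n.
have p2 : 0 <= 2 `^ r :> R by exact: powR_ge0.
have pe : 0 <= eta `^ r by exact: powR_ge0.
have rem_mem b c : b \in S -> c \in s -> c != b -> c \in rem b s.
  by move=> /Ss bs cs cb; rewrite mem_rem_uniq// !inE cb.
have rem0 b : b \in S -> rem b s != [::].
  move=> bS; have [c [cs cb _]] := nbr b bS.
  by apply: contraTneq (rem_mem _ _ bS cs cb) => ->.
(* The open Voronoi cell of b. *)
pose W b x := rho x b < dist x (rem b s).
have Wuniq x : (count (fun b => W b x) S <= 1)%N.
  rewrite -size_filter.
  have : uniq ([seq b <- S | W b x]) by exact: filter_uniq.
  have : forall b, b \in [seq b <- S | W b x] -> W b x && (b \in S).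
    by move=> b; rewrite mem_filter.
  case: [seq b <- S | W b x] => [//|b [//|c t]] H /=; rewrite inE negb_or => /andP[/andP[bc _] _].
  have /andP[Wb bS] := H b (mem_head _ _).
  have /andP[Wc cS] : W c x && (c \in S) by apply: H; rewrite !inE eqxx orbT.
  have := lt_le_trans Wb (dist_le_mem x (rem_mem _ _ bS (Ss _ cS) _)).
  have := lt_le_trans Wc (dist_le_mem x (rem_mem _ _ cS (Ss _ bS) bc)).
  by rewrite eq_sym bc => /lt_trans H1 /(_ isT)/H1; rewrite ltxx.
have ptw x : \sum_(b <- S) dist x (rem b s) `^ r <=
    2 `^ r * eta `^ r + (k + 2 `^ r) * dist x s `^ r.
  pose Q := 2 `^ r * (dist x s `^ r + eta `^ r).
  have Q0 : 0 <= Q by rewrite mulr_ge0// addr_ge0// powR_ge0.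
  apply: (@le_trans _ _ (\sum_(b <- S) (dist x s `^ r + Q * (W b x)%:R))).
    rewrite [leLHS]big_seq [leRHS]big_seq; apply: ler_sum => b bS.
    have [Wb|Wb] := boolP (W b x); last first.
      rewrite mulr0 addr0 le_powR ?(ltW r0) ?dist_ge0//.
      by apply: dist_rem_le; [exact: Ss|exact: rem0|rewrite leNgt].
    have [c [cs cb bc]] := nbr b bS.
    have xb : rho x b <= dist x s.
      have s0 : s != [::] by apply: contraTneq cs => ->.
      have [e es ->] := set_dist_attained rho_ge0 x s0.
      have [->//|eb] := eqVneq e b.
      by apply: ltW; apply: lt_le_trans Wb _; apply: dist_le_mem; exact: rem_mem.
    rewrite mulr1; apply: (@le_trans _ _ ((dist x s + eta) `^ r)).
      rewrite le_powR ?(ltW r0) ?dist_ge0//.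
      apply: le_trans (dist_le_mem x (rem_mem _ _ bS cs cb)) _.
      by apply: le_trans (chart_rho_triangle C x b c) _; rewrite lerD.
    apply: le_trans (powRD_le _ _ _) _; rewrite ?(ltW r0) ?dist_ge0//.
    by rewrite lerDr powR_ge0.
  rewrite big_split/= big_const_seq count_predT iter_addr_0 -mulr_sumr.
  have -> : \sum_(b <- S) (W b x)%:R = (count (fun b => W b x) S)%:R :> R.
    by rewrite -sum1_count natr_sum [RHS]big_mkcond/=; apply: eq_bigr => b _; case: (W b x).
  rewrite -[_ *+ size S]mulr_natl -/k.
  apply: (@le_trans _ _ (k * dist x s `^ r + Q)).
    by rewrite lerD2l ler_piMr// lern1.
  rewrite /Q mulrDr mulrDl; lra.
have I1 : ((k * X)%:E <= \sum_(b <- S) distort (rem b s))%E.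
  rewrite mulr_natl -[X *+ _](addr0) -iter_addr -(count_predT S).
  rewrite -big_const_seq -sumEFin big_seq [leRHS]big_seq.
  by apply: lee_sum => b bS; exact: HX.
have I2 : (\sum_(b <- S) distort (rem b s) =
    \int[P]_x (\sum_(b <- S) dist x (rem b s) `^ r)%:E)%E.
  rewrite /distortion -ge0_integral_sum//.
  - by apply: eq_integral => x _; rewrite sumEFin.
  - by move=> b; exact: measurable_dist_pow C _ _.
  - by move=> b x _; rewrite lee_fin powR_ge0.
rewrite -/k -lee_fin; apply: le_trans I1 _; rewrite I2.
apply: le_trans (@integral_le_addM _ _ _ P _ (cst (2 `^ r * eta `^ r)%:E)
  (fun x => (dist x s `^ r)%:E) (k + 2 `^ r) _ _ _ _ _ _ _ _) _.
- exact: addr_ge0.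
- apply/measurable_EFinP; apply: measurable_sum => b.
  by apply/measurable_EFinP; exact: measurable_dist_pow C _ _.
- exact: measurable_cst.
- exact: measurable_dist_pow C _ _.
- by move=> x; rewrite lee_fin sumr_ge0// => b _; rewrite powR_ge0.
- by move=> x; rewrite lee_fin mulr_ge0.
- by move=> x; rewrite lee_fin powR_ge0.
- by apply/aeW => x; rewrite /= -EFinM -EFinD lee_fin.
rewrite integral_cst_probability.
apply: (@le_trans _ _ ((2 `^ r * eta `^ r)%:E + (k + 2 `^ r)%:E * V%:E)%E).
  by rewrite leeD2l// lee_wpmul2l// lee_fin addr_ge0.
by rewrite -EFinM -EFinD lee_fin mulrDl mulrDr; lra.
Qed.

End increments.

Section decay.
Context (R : realType) (d : nat) dT (T : measurableType dT)
  (mu : {measure set T -> \bar R}) (rho : T -> T -> R) (crd : T -> 'I_d -> R)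
  (mkp : ('I_d -> R) -> T) (a : R).
Context (C : chart mu rho crd mkp a).
Context (P : probability T R) (f : T -> R) (Pf : has_density P mu f).
Context (r : R) (r0 : 0 < r).

Let d_gt0 := chart_dim C.
Let a0 := chart_const C.
Let rho_ge0 := chart_rho_ge0 C.

Local Notation dist x s := (set_dist rho x [set` s]).
Local Notation distort s := (distortion rho r P [set` s]).

Lemma density_cube_le A M v t : measurable A -> 0 <= M -> 0 <= t ->
  (forall x, A x -> f x <= M) ->
  (P (A `&` closed_cube crd v t) <= (M * (2 * t) ^+ d)%:E)%E.
Proof.
move=> mA M0 t0 fM; have [mf f0 ->] := Pf; last first.
  by apply: measurableI => //; exact: measurable_closed_cube C v t.
have mQ : measurable (closed_cube crd v t) by exact: measurable_closed_cube C v t.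
apply: (@le_trans _ _ (\int[mu]_(x in A `&` closed_cube crd v t) (cst M%:E) x)%E).
  apply: ge0_le_integral => //.
  - exact: measurableI.
  - by move=> x _; rewrite lee_fin.
  - by apply/measurable_EFinP; exact: measurable_funTS.
  - by move=> x [Ax _]; rewrite lee_fin fM.
rewrite integral_cst; last exact: measurableI.
rewrite EFinM; apply: lee_wpmul2l; rewrite ?lee_fin//.
rewrite -(chart_box C v t0).
by apply: le_measure; rewrite ?inE//; exact: measurableI.
Qed.

(** The sets where both [f] and the coordinates are at most [j] increase to the
    whole space. *)
Lemma density_mass : exists j : nat, exists A : set T,
  [/\ measurable A, A `<=` box crd j%:R, (forall x, A x -> f x <= j%:R) &
      (2^-1%:E <= P A)%E].
Proof.
have [mf f0 _] := Pf.
pose A (j : nat) := box crd j%:R `&` [set x | f x <= j%:R].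
have mA j : measurable (A j).
  apply: measurableI; first exact: measurable_box C _.
  have mb : measurable_fun setT (fun x => f x <= j%:R) by exact: measurable_fun_ler.
  rewrite (_ : [set x | _] = (fun x => f x <= j%:R) @^-1` [set true])//.
  by rewrite -[X in measurable X]setTI; exact: mb.
have AT : \bigcup_j A j = setT.
  apply/seteqP; split => // x _.
  pose m := \sum_i `|crd x i| + f x.
  have m0 : 0 <= m by rewrite addr_ge0// sumr_ge0.
  exists (Num.truncn m).+1 => //.
  have /andP[_ /ltW mm] := truncn_itv m0.
  split => [i|]; apply: le_trans mm; rewrite /m.
    rewrite (bigD1 i)//= -addrA lerDl addr_ge0// sumr_ge0//.
  by rewrite lerDr sumr_ge0.
have Acvg : (P (A j) @[j --> \oo] --> 1%E)%classic.
  rewrite -[X in _ --> X](@probability_setT _ _ _ P) -AT.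
  apply: nondecreasing_cvg_mu => //; first by rewrite AT.
  move=> i j ij; apply/subsetPset => x [bx fx]; split.
    by move=> k; rewrite (le_trans (bx k))// ler_nat.
  by rewrite /= (le_trans fx)// ler_nat.
have [H|H] := pselect (exists j, (2^-1%:E <= P (A j))%E).
  by have [j Hj] := H; exists j, (A j); split => // x [].
have : (1 <= 2^-1%:E :> \bar R)%E.
  rewrite -(cvg_lim _ Acvg)//; apply: lime_le; first by apply/cvg_ex; exists 1%E.
  by apply: nearW => j; rewrite leNgt; apply/negP => /ltW Hj; apply: H; exists j.
by rewrite lee_fin leNgt invf_lt1 ?ltr1n.
Qed.

(** If only [k] points of the codebook lie in a bounded region, then the cubes of
    radius of order [k.+1 ^ (- 1 / d)] around them cannot carry the mass found by
    [density_mass], since [f] is bounded there; on the remaining mass the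
    distance is at least of that order. The successor of the count accounts for
    codebooks with no point in the region. *)
Lemma count_points (K : R) : 0 <= K -> exists L c : R, [/\ 0 <= L, 0 < c &
  forall (n : nat) (s : seq T), (0 < n)%N -> s != [::] ->
    (distort s <= (K * rate R d n `^ r)%:E)%E ->
    c * (rate R d n ^+ d)^-1 <= (count (fun x => `[< box crd L x >]) s).+1%:R].
Proof.
move=> K0; have [j [A [mA Aj fj PA]]] := density_mass.
pose M : R := j%:R + 1.
have M1 : 1 <= M by rewrite lerDr.
have M0 : 0 < M by lra.
have jM : j%:R <= M by rewrite /M; lra.
(* K + 1 instead of K makes the constant positive. *)
pose K' := 4 * (K + 1).
have K'0 : 0 < K' by rewrite /K'; lra.
pose kap := K' `^ r^-1.
have kap0 : 0 < kap by rewrite powR_gt0.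
have c0 : 0 < (4 * M * (2 * a * kap) ^+ d)^-1.
  by rewrite invr_gt0 !mulr_gt0// exprn_gt0// !mulr_gt0.
exists (j%:R + 1), (4 * M * (2 * a * kap) ^+ d)^-1; split => //.
move=> n s n0 s0 Hs; set z := rate R d n in Hs *.
have z0 : 0 < z by exact: rate_gt0.
pose s' := [seq x <- s | `[< box crd (j%:R + 1) x >]].
rewrite -size_filter -/s'; set k := size s'.
have k1 : 0 < k.+1%:R :> R by rewrite ltr0n.
(* w is the common volume of the cubes, chosen so that k cubes carry a mass
   of at most 1 / 4. *)
pose w := (4 * M * k.+1%:R)^-1.
have w0 : 0 < w by rewrite invr_gt0 !mulr_gt0.
have w1 : w <= 1.
  rewrite /w invf_le1 ?mulr_gt0//; have : 1 <= k.+1%:R :> R by rewrite ler1n.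
  by move=> k1'; rewrite -[1]mul1r ler_pM//; lra.
pose t := w `^ d%:R^-1 / (2 * a).
have t0 : 0 < t by rewrite divr_gt0 ?mulr_gt0 ?powR_gt0.
have at2 : 2 * (a * t) = w `^ d%:R^-1 by rewrite /t; field; rewrite gt_eqF.
have td : (2 * (a * t)) ^+ d = w.
  rewrite at2 -powR_mulrn ?powR_ge0// -powRrM mulVf ?powRr1 ?(ltW w0)//.
  by rewrite pnatr_eq0 -lt0n.
have at1 : a * t <= 1.
  have : w `^ d%:R^-1 <= 1.
    by rewrite -[leRHS](powR1E d%:R^-1); apply: le_powR => //; exact: ltW.
  by rewrite -at2; have := mulr_gt0 a0 t0; lra.
pose U := A `&` [set x | t <= dist x s].
have mU : measurable U.
  apply: measurableI => //.
  exact: measurable_dist_ge C _ _.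
have PU : (4^-1%:E <= P U)%E.
  have sub : A `<=` U `|` \big[setU/set0]_(b <- s') (A `&` closed_cube crd (crd b) (a * t)).
    move=> x Ax; have [tx|xt] := leP t (dist x s); first by left.
    right; have [b bs xb] := set_dist_attained rho_ge0 x s0.
    rewrite xb in xt; rewrite -bigcup_seq; exists b => /=.
      rewrite mem_filter bs andbT; apply/asboolP => i.
      have := Aj _ Ax i; have := chart_crd_le C x b i.
      have : a * rho x b <= 1.
        by apply: le_trans at1; rewrite ler_pM2l// ltW.
      rewrite !ler_norml => h1 /andP[h2 h3] /andP[h4 h5].
      by apply/andP; split; lra.
    split => // i; apply: le_trans (chart_crd_le C x b i) _.
    by rewrite ler_pM2l// ltW.
  have mQ b : measurable (A `&` closed_cube crd (crd b) (a * t)).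
    by apply: measurableI => //; exact: measurable_closed_cube C _ _.
  have P1 u : (P (\big[setU/set0]_(b <- u) (A `&` closed_cube crd (crd b) (a * t)))
      <= ((size u)%:R * (M * w))%:E)%E.
    elim: u => [|b u IH].
      by rewrite big_nil measure0 mul0r.
    rewrite big_cons; apply: le_trans (measureU2 _ _ _) _ => //.
      by apply: bigsetU_measurable.
    rewrite [size _]/= -natr1 mulrDl mul1r addrC EFinD; apply: leeD => //.
    rewrite -td.
    apply: (density_cube_le _ mA (ltW M0) (mulr_ge0 (ltW a0) (ltW t0))).
    by move=> x /fj /le_trans; apply.
  have P2 : (P A <= P U + (k%:R * (M * w))%:E)%E.
    apply: le_trans (le_measure P _ _ sub) _; rewrite ?inE//.
      by apply: measurableU => //; exact: bigsetU_measurable.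
    apply: le_trans (measureU2 _ _ _) _ => //; first exact: bigsetU_measurable.
    by apply: leeD2l; exact: P1.
  have kw : k%:R * (M * w) <= 4^-1.
    have -> : k%:R * (M * w) = (k%:R / k.+1%:R) * 4^-1.
      by rewrite /w; field; rewrite !gt_eqF.
    by rewrite ler_piMl// ler_pdivrMr// mul1r ler_nat.
  have : (2^-1%:E <= P U + 4^-1%:E)%E.
    by apply: le_trans PA _; apply: le_trans P2 _; rewrite leeD2l// lee_fin.
  rewrite -leeBlDr//; apply: le_trans; rewrite -EFinB lee_fin; lra.
have tK : t `^ r <= K' * z `^ r.
  have : ((t `^ r)%:E * P U <= distort s)%E.
    by apply: (distortion_ge_mass C P r0 mU (ltW t0)) => x [].
  have : ((t `^ r)%:E * 4^-1%:E <= (t `^ r)%:E * P U)%E.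
    by apply: lee_wpmul2l => //; rewrite lee_fin powR_ge0.
  move=> /le_trans H1 /H1 {H1} /le_trans H1; have := H1 _ Hs.
  rewrite -EFinM lee_fin /K'; have := powR_ge0 z r; lra.
have {}tK : t <= kap * z.
  apply: le_trans (powR_le_root r0 (ltW t0) tK) _.
  by rewrite powRM ?powR_ge0 ?(ltW K'0)// -powRrM divff ?gt_eqF// powRr1// ltW.
have : w <= (2 * a * kap) ^+ d * z ^+ d.
  rewrite -exprMn -td; apply: lerXn2r; rewrite ?nnegrE.
  - by rewrite mulr_ge0// mulr_ge0// ltW.
  - by rewrite mulr_ge0 ?(ltW z0)// mulr_ge0 ?(ltW kap0)// mulr_ge0// ltW.
  - by rewrite -!mulrA ler_pM2l// ler_pM2l.
set B := (2 * a * kap) ^+ d; set Z := z ^+ d => wB.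
have B0 : 0 < B by rewrite exprn_gt0// !mulr_gt0.
have Z0 : 0 < Z by rewrite exprn_gt0.
rewrite -invfM invf_ple ?posrE ?mulr_gt0//.
have : w * (4 * M) <= B * Z * (4 * M) by rewrite ler_pM2r// mulr_gt0.
have -> : w * (4 * M) = k.+1%:R^-1 by rewrite /w; field; rewrite !gt_eqF.
by move=> /le_trans; apply; rewrite le_eqVlt; apply/orP; left; apply/eqP; ring.
Qed.

End decay.

(** Codebooks are duplicate-free lists, from which points can be counted and
    deleted. *)
Definition optimal_codebooks dT (T : measurableType dT) (R : realType)
    (rho : T -> T -> R) (r : R) (P : set T -> \bar R) (alpha : nat -> seq T) :=
  forall n, (0 < n)%N ->
    [/\ alpha n != [::], (size (alpha n) <= n)%N, uniq (alpha n) &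
      forall s, s != [::] -> (size s <= n)%N ->
        (distortion rho r P [set` alpha n] <= distortion rho r P [set` s])%E].

Section optimal.
Context (R : realType) (d : nat) dT (T : measurableType dT)
  (mu : {measure set T -> \bar R}) (rho : T -> T -> R) (crd : T -> 'I_d -> R)
  (mkp : ('I_d -> R) -> T) (a : R).
Context (C : chart mu rho crd mkp a).
Context (P : probability T R) (f : T -> R) (Pf : has_density P mu f).
Context (r delta : R) (r0 : 0 < r) (delta0 : 0 < delta).

Local Notation o := (mkp (fun=> 0)).

Context (moment : (\int[P]_x (rho x o `^ (r + delta))%:E < +oo)%E).
Context (alpha : nat -> seq T) (opt : optimal_codebooks rho r P alpha).

Let d_gt0 := chart_dim C.
Let a0 := chart_const C.
Let rho_ge0 := chart_rho_ge0 C.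

Local Notation dist x s := (set_dist rho x [set` s]).
Local Notation distort s := (distortion rho r P [set` s]).
Local Notation z n := (rate R d n).

Lemma optimal_distortion_rate : exists2 K : R, 0 <= K &
  forall n, (0 < n)%N -> (distort (alpha n) <= (K * z n `^ r)%:E)%E.
Proof.
have [K K0 HK] := pierce C r0 delta0 moment.
exists K => // n n0; have [s [s0 sn /(le_trans _)]] := HK n n0; apply.
by have [_ _ _] := opt n0; apply.
Qed.

(** By [count_points] and [packing], at least [c / 4 * n] points of the codebook
    of size [n.+1] have a neighbour at distance of order [e], and
    [distortion_rem_point] applies to them. *)
Lemma optimal_distortion_increment : exists2 K : R, 0 <= K &
  forall n, (0 < n)%N ->
    (distort (alpha n) <=
      distort (alpha n.+1) + (K * (z n `^ r * z n ^+ d))%:E)%E.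
Proof.
have [K K0 HK] := optimal_distortion_rate.
have [L [c [L0 c0 Hc]]] := count_points C Pf r0 K0.
have p2 : 0 <= 2 `^ r :> R by exact: powR_ge0.
pose B := 2 * L + 1; have B1 : 1 <= B by rewrite /B; lra.
have B0 : 0 < B by lra.
(* With mesh h = kap * e, a set of h-separated points of the region has at
   most (B / h) ^ d = c / 4 * e ^ (- d) elements. *)
pose kap := B * (4 / c) `^ d%:R^-1.
have kap0 : 0 < kap by rewrite mulr_gt0 ?powR_gt0 ?divr_gt0.
have kapd : kap ^+ d = B ^+ d * (4 / c).
  rewrite exprMn -[X in _ * X]powR_mulrn ?powR_ge0// -powRrM mulVf ?powRr1//.
    by rewrite divr_ge0// ltW.
  by rewrite pnatr_eq0 -lt0n.
(* When e ^ d >= th, only finitely many n are concerned and the trivial bound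
   V n <= K * e ^ r is enough. *)
pose th := Num.min ((kap^-1) ^+ d) (c / 2).
have th0 : 0 < th by rewrite lt_min exprn_gt0 ?invr_gt0// divr_gt0.
pose K1 := 2 `^ r * (K + (a * kap) `^ r) * (4 / c).
have K10 : 0 <= K1.
  apply: mulr_ge0; last by rewrite divr_ge0// ltW.
  by apply: mulr_ge0 => //; rewrite addr_ge0 ?powR_ge0.
exists (K / th + K1); first by rewrite addr_ge0// divr_ge0// ltW.
move=> n n0; set e := z n.
have e0 : 0 < e by exact: rate_gt0.
have ed0 : 0 < e ^+ d by rewrite exprn_gt0.
have er0 : 0 < e `^ r by rewrite powR_gt0.
have [an0 ans _ anopt] := opt n0.
have [s0 ss us sopt] := opt (ltn0Sn n).
set s := alpha n.+1 in s0 ss us sopt *.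
have Vle : (distort s <= (K * e `^ r)%:E)%E.
  by apply: le_trans (HK n n0); apply: sopt => //; exact: leqW.
have Vfin : distort s \is a fin_num.
  exact: ge0_le_fin_num (distortion_ge0 _ _ _ _) Vle.
have Xfin : distort (alpha n) \is a fin_num.
  exact: ge0_le_fin_num (distortion_ge0 _ _ _ _) (HK n n0).
pose V := fine (distort s); pose X := fine (distort (alpha n)).
have VE : distort s = V%:E by rewrite (fineK Vfin).
have XE : distort (alpha n) = X%:E by rewrite (fineK Xfin).
have V0 : 0 <= V by apply: fine_ge0; exact: distortion_ge0.
have VK : V <= K * e `^ r by rewrite -lee_fin (fineK Vfin); exact: Vle.
have XK : X <= K * e `^ r by rewrite -lee_fin (fineK Xfin); exact: HK.
apply: (le_fine_addr Xfin Vfin).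
change (X <= V + (K / th + K1) * (e `^ r * e ^+ d)).
clearbody V X.
rewrite mulrDl; set Q := e `^ r * e ^+ d.
have Q0 : 0 < Q by rewrite mulr_gt0.
have [the|eth] := leP th (e ^+ d).
  apply: (@le_trans _ _ (K / th * Q)); last first.
    by rewrite addrCA lerDl addr_ge0// mulr_ge0// ltW.
  apply: le_trans XK _.
  have t1 : 1 <= e ^+ d / th by rewrite ler_pdivlMr ?mul1r.
  have -> : K / th * Q = K * e `^ r * (e ^+ d / th) by rewrite /Q; ring.
  by apply: ler_peMr => //; rewrite mulr_ge0// ltW.
have [ek ec] : e ^+ d < (kap^-1) ^+ d /\ e ^+ d < c / 2.
  by apply/andP; rewrite -lt_min.
have {}ek : e < kap^-1.
  rewrite ltNge; apply/negP => ke; move: ek; rewrite ltNge => /negP; apply.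
  by apply: lerXn2r => //; rewrite nnegrE ?invr_ge0 ltW.
pose h := kap * e.
have h0 : 0 < h by rewrite mulr_gt0.
have h1 : h <= 1.
  by rewrite /h mulrC -ler_pdivlMr// mul1r ltW.
have := Hc n s n0 s0 Vle.
rewrite -/e -size_filter; set S := [seq x <- s | _] => kS.
pose nbr x := has (fun y => (y != x) && `[< forall i, `|crd x i - crd y i| < h >]) s.
(* S2 is h-separated, S1 collects the candidates for deletion. *)
pose S1 := [seq x <- S | nbr x]; pose S2 := [seq x <- S | predC nbr x].
have SS : (size S1 + size S2)%:R = (size S)%:R :> R.
  by rewrite !size_filter count_predC -size_filter.
have S2le : (size S2)%:R <= c / 4 * (e ^+ d)^-1.
  apply: (@le_trans _ _ ((2 * L / h + 1) ^+ d)).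
    apply: (packing L0 h0).
    - by rewrite !filter_uniq.
    - by move=> x; rewrite !mem_filter => /andP[_ /andP[/asboolP bx _]].
    - move=> x y; rewrite !mem_filter => /andP[/hasPn nx _] /andP[_ /andP[_ ys]] xy H.
      have := nx _ ys; rewrite eq_sym xy /= => /negP; apply; exact/asboolP.
  have -> : c / 4 * (e ^+ d)^-1 = (B / h) ^+ d.
    rewrite expr_div_n exprMn kapd; field.
    by rewrite !gt_eqF ?exprn_gt0.
  have hinv : 1 <= h^-1 by rewrite invf_ge1.
  have LB : 2 * L / h + 1 <= B / h.
    have -> : B / h = 2 * L / h + h^-1 by rewrite /B; ring.
    by rewrite lerD2l.
  have hi0 : 0 <= h^-1 by rewrite invr_ge0 ltW.
  by apply: lerXn2r => //; rewrite nnegrE ?addr_ge0// mulr_ge0// ?mulr_ge0// ltW.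
have S1ge : c / 4 * (e ^+ d)^-1 <= (size S1)%:R.
  have : 2 <= c * (e ^+ d)^-1.
    by rewrite ler_pdivlMr// mulrC -ler_pdivlMr// ltW.
  rewrite natrD in SS; rewrite -[(size S).+1%:R]natr1 in kS.
  move: S2le kS SS; rewrite (_ : c / 4 * (e ^+ d)^-1 = c * (e ^+ d)^-1 / 4); last by ring.
  move: (c * (e ^+ d)^-1) => w; lra.
have S1pos : 0 < (size S1)%:R :> R.
  by apply: lt_le_trans S1ge; rewrite mulr_gt0 ?invr_gt0// divr_gt0.
have := @distortion_rem_point _ _ _ _ _ _ _ _ _ C P _ r0 s S1 (a * h) V X us.
move=> /(_ (filter_uniq _ (filter_uniq _ us))) H.
have {}H : (size S1)%:R * X <= (size S1)%:R * V + 2 `^ r * (V + (a * h) `^ r).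
  apply: H.
  - by move=> x; rewrite !mem_filter => /andP[_ /andP[]].
  - by rewrite mulr_ge0 ?ltW.
  - move=> b; rewrite mem_filter => /andP[/hasP[y ys /andP[yb /asboolP H]] _].
    exists y; split => //; apply: (chart_rho_le C) => i; exact/ltW/H.
  - by rewrite VE.
  - move=> b; rewrite mem_filter => /andP[/hasP[y ys /andP[yb _]] bS].
    have bs : b \in s by move: bS; rewrite mem_filter => /andP[].
    rewrite -XE; apply: anopt.
      by apply: contraTneq (_ : y \in rem b s) => [->//|]; rewrite mem_rem_uniq// !inE yb.
    by rewrite size_rem// -ltnS prednK// lt0n size_eq0.
apply: (@le_trans _ _ (V + K1 * Q)); last first.
  by rewrite lerD2l lerDr mulr_ge0 ?divr_ge0// ltW.
have ah : (a * h) `^ r = (a * kap) `^ r * e `^ r.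
  by rewrite /h mulrA powRM//; [exact: mulr_ge0 (ltW a0) (ltW kap0)|exact: ltW].
have {}H : (size S1)%:R * (X - V) <= 2 `^ r * ((K + (a * kap) `^ r) * e `^ r).
  rewrite mulrBr lerBlDl; apply: le_trans H _; rewrite lerD2l.
  by apply: ler_wpM2l => //; rewrite ah mulrDl lerD2r.
rewrite -lerBlDl.
have XV : X - V <= 2 `^ r * ((K + (a * kap) `^ r) * e `^ r) / (size S1)%:R.
  by rewrite ler_pdivlMr// mulrC.
apply: le_trans XV _.
have -> : K1 * Q = 2 `^ r * ((K + (a * kap) `^ r) * e `^ r) * (4 / c * e ^+ d).
  by rewrite /K1 /Q; ring.
apply: ler_wpM2l; first by rewrite !mulr_ge0 ?addr_ge0 ?powR_ge0.
rewrite -[4 / c * _]invrK lef_pV2 ?posrE ?invr_gt0 ?mulr_gt0 ?invr_gt0//.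
by rewrite invfM invf_div.
Qed.

(** Adding [y] to the codebook of size [n] cannot beat the optimal codebook of
    size [n.+1], so that the gain of [distortion_add_point] is bounded by the
    increment. *)
Lemma local_mass : exists2 K : R, 0 <= K &
  forall n (b : R) (y : T), (0 < n)%N -> 0 <= b -> b <= 4^-1 ->
    ((dist y (alpha n) `^ r)%:E *
       P [set x | (rho x y <= b * dist y (alpha n))%R] <=
     (K * (z n `^ r * z n ^+ d))%:E)%E.
Proof.
have [K K0 HK] := optimal_distortion_increment.
have [K1 K10 HK1] := optimal_distortion_rate.
pose q := (3 / 4) `^ r - (1 / 4) `^ r : R.
have q0 : 0 < q.
  by rewrite subr_gt0 gt0_ltr_powR ?nnegrE//; lra.
exists (K / q); first by rewrite divr_ge0// ltW.
move=> n b y n0 b0 b4; set pB := (X in (_ * X)%E).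
have [an0 ans _ anopt] := opt n0.
have [s0 ss us sopt] := opt (ltn0Sn n).
have A := distortion_add_point C P r0 y an0 b0 b4; rewrite -/pB -/q in A.
have Bd : (distort (alpha n.+1) <= distort (y :: alpha n))%E by exact: sopt.
have Vfin : distort (alpha n.+1) \is a fin_num.
  exact: ge0_le_fin_num (distortion_ge0 _ _ _ _) (HK1 n.+1 (ltn0Sn n)).
have : (distort (alpha n.+1) + (q * dist y (alpha n) `^ r)%:E * pB <=
    distort (alpha n.+1) + (K * (z n `^ r * z n ^+ d))%:E)%E.
  apply: le_trans (HK n n0); apply: le_trans A; exact: leeD2r.
rewrite leeD2lE// => {}A.
have -> : K / q * (z n `^ r * z n ^+ d) = q^-1 * (K * (z n `^ r * z n ^+ d)).
  by ring.
have pfin : pB \is a fin_num by rewrite /pB fin_num_measure//; exact: measurable_ball_rho C _ _.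
rewrite -(fineK pfin) -EFinM lee_fin in A.
rewrite -(fineK pfin) -EFinM lee_fin ler_pdivlMl// [leLHS]mulrA.
exact: A.
Qed.

End optimal.

(** * Mismatched moments of the quantization error *)

Section mismatch.
Context (R : realType) (d : nat) dT (T : measurableType dT)
  (mu : {measure set T -> \bar R}) (rho : T -> T -> R) (crd : T -> 'I_d -> R)
  (mkp : ('I_d -> R) -> T) (a : R).
Context (C : chart mu rho crd mkp a).
Context (P : probability T R) (f : T -> R) (Pf : has_density P mu f).
Context (r delta : R) (r0 : 0 < r) (delta0 : 0 < delta).

Local Notation o := (mkp (fun=> 0)).

Context (moment : (\int[P]_x (rho x o `^ (r + delta))%:E < +oo)%E).
Context (alpha : nat -> seq T) (opt : optimal_codebooks rho r P alpha).

Let d_gt0 := chart_dim C.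
Let a0 := chart_const C.
Let rho_ge0 := chart_rho_ge0 C.

Local Notation dist x s := (set_dist rho x [set` s]).
Local Notation distort s := (distortion rho r P [set` s]).
Local Notation z n := (rate R d n).

(** Some bounded set has mass at least [1 / 2], and a codebook far from it would
    have a larger distortion than the bound of [optimal_distortion_rate]. *)
Lemma dist_optimal_le : exists2 D : R, 0 <= D &
  forall n x, (0 < n)%N -> dist x (alpha n) <= rho x o + D.
Proof.
have [K K0 HK] := optimal_distortion_rate C r0 delta0 moment opt.
have [j [A [mA Aj _ PA]]] := density_mass C Pf.
exists (a * j%:R + (2 * K) `^ r^-1).
  by rewrite addr_ge0 ?powR_ge0// mulr_ge0// ltW.
move=> n x n0; have [an0 _ _ _] := opt n0.
apply: le_trans (dist_triangle C x o an0) _; rewrite lerD2l -lerBlDl.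
set t := _ - _.
have [t0|/ltW t0] := leP t 0; first by rewrite (le_trans t0)// powR_ge0.
apply: powR_le_root => //.
have : ((t `^ r)%:E * P A <= distort (alpha n))%E.
  apply: (distortion_ge_mass C P r0 mA t0) => y Ay; rewrite lerBlDl.
  apply: le_trans (dist_triangle C o y an0) _; rewrite lerD2r.
  apply: (chart_rho_le C) => i; rewrite (chart_mkpK C) sub0r normrN.
  exact: Aj.
have : ((t `^ r)%:E * 2^-1%:E <= (t `^ r)%:E * P A)%E.
  by apply: lee_wpmul2l => //; rewrite lee_fin powR_ge0.
move=> /le_trans H1 /H1 {H1} /le_trans H1; have := H1 _ (HK n n0).
rewrite -EFinM lee_fin => H.
have : K * z n `^ r <= K.
  rewrite ler_piMr// -[leRHS](powR1E r) le_powR ?(ltW r0) ?rate_le1//.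
  by rewrite ltW// rate_gt0.
move: H; lra.
Qed.

Lemma measurable_level L t n :
  measurable (box crd L `&` [set x | t <= dist x (alpha n)]).
Proof.
apply: measurableI; first exact: measurable_box C L.
exact: measurable_dist_ge C _ _.
Qed.

(** Cover the level set by cubes of side proportional to [t] and bound the mass
    of each of them by [local_mass]. *)
Lemma level_mass_le L : 0 <= L -> exists2 M : R, 0 <= M &
  forall n t, (0 < n)%N -> 0 < t ->
    (P (box crd L `&` [set x | (t <= dist x (alpha n))%R]) <=
      (M * (z n / t) `^ (d%:R + r))%:E)%E.
Proof.
move=> L0; have [K K0 HK] := local_mass C Pf r0 delta0 moment opt.
have [D D0 HD] := dist_optimal_le.
pose G := 8 * a * L + a * L + D.
have aL : 0 <= a * L by rewrite mulr_ge0// ltW.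
have G0 : 0 <= G by rewrite /G; lra.
exists (G ^+ d * K); first by rewrite mulr_ge0// exprn_ge0.
move=> n t n0 t0; set A := _ `&` _.
have z0 : 0 < z n by exact: rate_gt0.
have mA : measurable A by exact: measurable_level.
(* Beyond the largest possible distance, the level set is empty. *)
have [tD|tD] := ltP (a * L + D) t.
  rewrite (_ : A = set0) ?measure0.
    by rewrite lee_fin !mulr_ge0 ?exprn_ge0 ?powR_ge0.
  apply/seteqP; split => // x [bx /= tx].
  have : rho x o <= a * L.
    by apply: (chart_rho_le C) => i; rewrite (chart_mkpK C) subr0; exact: bx.
  have := HD n x n0; move: tx tD; lra.
pose h := t / (4 * a).
have h0 : 0 < h by rewrite divr_gt0// mulr_gt0.
pose p := K * (z n `^ r * z n ^+ d) / t `^ r.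
have p0 : 0 <= p.
  by rewrite /p divr_ge0 ?powR_ge0// mulr_ge0// mulr_ge0 ?powR_ge0 ?exprn_ge0// ltW.
apply: le_trans (covering C L0 h0 (nu := P) mA _ p0 _) _.
- by move=> x [].
- move=> x [bx /= tx].
  have q0 : 0 <= 4^-1 :> R by lra.
  have := HK n 4^-1 x n0 q0 (lexx _); set B := (X in (P X)%E) => PB.
  have mB : measurable B by exact: measurable_ball_rho C _ _.
  have sub : open_cube crd (crd x) h `<=` B.
    move=> y yx; apply: (@le_trans _ _ (a * h)).
      by apply: (chart_rho_le C) => i; exact/ltW/yx.
    have -> : a * h = 4^-1 * t by rewrite /h; field; rewrite gt_eqF.
    by rewrite ler_wpM2l.
  apply: (@le_trans _ _ (P B)).
    by apply: le_measure; rewrite ?inE//; exact: measurable_open_cube C _ _.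
  have PBf : P B \is a fin_num by rewrite fin_num_measure.
  rewrite -(fineK PBf) lee_fin /p ler_pdivlMr ?powR_gt0// mulrC.
  rewrite -lee_fin; apply: le_trans PB; rewrite EFinM (fineK PBf).
  by apply: lee_wpmul2r => //; rewrite lee_fin le_powR ?(ltW r0) ?(ltW t0).
rewrite lee_fin.
have -> : 2 * L / h + 1 = (8 * a * L + t) / t.
  by rewrite /h; field; rewrite !gt_eqF.
have td : 0 < t ^+ d by rewrite exprn_gt0.
have tr : 0 < t `^ r by rewrite powR_gt0.
have -> : (z n / t) `^ (d%:R + r) = z n `^ r * z n ^+ d / (t `^ r * t ^+ d).
  have zt : 0 <= z n / t by rewrite divr_ge0// ltW.
  rewrite powRD ?(gt_eqF (divr_gt0 z0 t0)) ?implybT// powR_mulrn//.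
  rewrite expr_div_n powRM ?(ltW z0) ?invr_ge0 ?(ltW t0)//.
  rewrite powRV ?(ltW t0)//.
  by field; rewrite !gt_eqF.
have -> : G ^+ d * K * (z n `^ r * z n ^+ d / (t `^ r * t ^+ d)) = (G / t) ^+ d * p.
  by rewrite /p expr_div_n; field; rewrite !gt_eqF.
apply: ler_wpM2r => //; apply: lerXn2r; rewrite ?nnegrE.
- by rewrite divr_ge0 ?(ltW t0)// addr_ge0 ?(ltW t0)// -mulrA mulr_ge0.
- by rewrite divr_ge0 ?(ltW t0).
- by rewrite ler_wpM2r ?invr_ge0 ?(ltW t0)// /G -addrA lerD2l.
Qed.

(** Cut the box along the level sets of height [2 ^ j * e]: the contributions
    form a geometric series of ratio [2 ^ (s - (d + r)) < 1]. *)
Lemma bounded_mismatch L s : 0 <= L -> 0 < s -> s < d%:R + r ->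
  exists2 K : R, 0 <= K & forall n, (0 < n)%N ->
    (\int[P]_x (dist x (alpha n) `^ s * \1_(box crd L) x)%:E <=
      (K * z n `^ s)%:E)%E.
Proof.
move=> L0 s0 sdr; have [M M0 HM] := level_mass_le L0.
have [D D0 HD] := dist_optimal_le.
have aL : 0 <= a * L by rewrite mulr_ge0// ltW.
pose w : R := d%:R + r.
have w0 : 0 < w by rewrite /w ltr_wpDl.
pose Q : R := 2 `^ s; pose W : R := 2 `^ w.
have Q0 : 0 < Q by rewrite powR_gt0.
have W0 : 0 < W by rewrite powR_gt0.
pose q := Q / W.
have q0 : 0 < q by rewrite divr_gt0.
have q1 : q < 1.
  rewrite ltr_pdivrMr// mul1r /Q /W.
  by rewrite /powR !gt_eqF// ltr_expR ltr_pM2r// ln_gt0 ?ltr1n.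
exists (1 + Q * M / (1 - q)).
  by rewrite addr_ge0// divr_ge0 ?subr_ge0 ?(ltW q1)// mulr_ge0// ltW.
move=> n n0; set e := z n.
have e0 : 0 < e by exact: rate_gt0.
have md : measurable_fun setT (fun x => dist x (alpha n)).
  by apply: measurable_set_dist => //; exact: chart_measurable_rho C.
(* The part B j of the box below the level j is treated by induction on j. *)
pose A j := box crd L `&` [set x | 2 ^+ j * e <= dist x (alpha n)].
have mA j : measurable (A j) by exact: measurable_level.
pose B j := box crd L `\` A j.
have mbox : measurable (box crd L) by exact: measurable_box C L.
have mB j : measurable (B j) by exact: measurableD.
have mI (S : set T) : measurable S ->
    measurable_fun setT (fun x => (dist x (alpha n) `^ s * \1_S x)%:E).
  move=> mS; apply/measurable_EFinP; apply: measurable_funM.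
    by apply/measurable_EFinP; exact: measurable_dist_pow C _ _.
  exact: measurable_indic.
have I0 (S : set T) x : (0 <= (dist x (alpha n) `^ s * \1_S x)%:E)%E.
  by rewrite lee_fin mulr_ge0 ?powR_ge0.
have es0 : 0 <= e `^ s by exact: powR_ge0.
have step j : (\int[P]_x (dist x (alpha n) `^ s * \1_(B j) x)%:E <=
    (e `^ s * (1 + Q * M * ((1 - q ^+ j) / (1 - q))))%:E)%E.
  elim: j => [|j IH].
    rewrite subrr mul0r mulr0 addr0 mulr1 -[leRHS](integral_cst_probability P).
    apply: ge0_le_integral => //; first exact: mI.
    move=> x _; rewrite lee_fin indicE; have [|_] := boolP (x \in B 0%N); last first.
      by rewrite mulr0.
    rewrite inE mulr1 => -[bx nA]; rewrite le_powR ?(ltW s0)// ?dist_ge0//.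
      exact: dist_ge0 C _ _.
    rewrite leNgt; apply/negP => /ltW ex; apply: nA; split => //=.
    by rewrite expr0 mul1r.
  have c0 : 0 <= (2 ^+ j.+1 * e) `^ s by exact: powR_ge0.
  apply: le_trans (@integral_le_addM _ _ _ P _
    (fun x => (dist x (alpha n) `^ s * \1_(B j) x)%:E)
    (fun x => (\1_(A j) x)%:E) _ c0 _ _ _ _ _ _ _) _ => //.
  - exact: mI.
  - exact: mI.
  - exact/measurable_EFinP/measurable_indic.
  - apply/aeW => x; rewrite -EFinM -EFinD lee_fin !indicE.
    have dx0 : 0 <= dist x (alpha n) `^ s by exact: powR_ge0.
    have [|_] := boolP (x \in B j.+1); last first.
      by rewrite mulr0 addr_ge0// mulr_ge0.
    rewrite inE => -[bx nA1]; rewrite mulr1.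
    have [xA|xA] := boolP (x \in A j).
      rewrite mulr1; apply: (@le_trans _ _ ((2 ^+ j.+1 * e) `^ s)); last first.
        by rewrite lerDr mulr_ge0.
      apply: le_powR; [exact: ltW|exact: dist_ge0 C _ _|].
      by rewrite leNgt; apply/negP => /ltW ex; apply: nA1.
    have -> : x \in B j by apply/mem_set; split => // /mem_set; exact/negP.
    by rewrite mulr1 mulr0 addr0.
  have -> : (\int[P]_x (\1_(A j) x)%:E = P (A j))%E by rewrite integral_indic// setIT.
  have tj : 0 < 2 ^+ j * e by rewrite mulr_gt0// exprn_gt0.
  apply: (@le_trans _ _ ((e `^ s * (1 + Q * M * ((1 - q ^+ j) / (1 - q))))%:E +
     ((2 ^+ j.+1 * e) `^ s)%:E * (M * (e / (2 ^+ j * e)) `^ w)%:E)%E).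
    by apply: leeD IH _; apply: lee_wpmul2l (HM _ _ n0 tj); rewrite lee_fin.
  rewrite -EFinM -EFinD lee_fin.
  have -> : (2 ^+ j.+1 * e) `^ s = Q ^+ j.+1 * e `^ s.
    by rewrite powRM ?(ltW e0) ?exprn_ge0// powRXn.
  have -> : e / (2 ^+ j * e) = (2 ^+ j)^-1.
    by field; rewrite !gt_eqF ?exprn_gt0.
  have -> : (2 ^+ j)^-1 `^ w = (W ^+ j)^-1.
    by rewrite powRV ?exprn_ge0// powRXn.
  have -> : Q ^+ j.+1 = Q * (q ^+ j * W ^+ j).
    by rewrite -exprMn exprS divfK// gt_eqF.
  rewrite le_eqVlt; apply/orP; left; apply/eqP.
  rewrite [q ^+ j.+1]exprS.
  by field; rewrite !gt_eqF ?exprn_gt0// subr_gt0.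
have [J HJ] : exists J : nat, a * L + D < 2 ^+ J * e.
  exists (Num.truncn ((a * L + D) / e)).+1.
  have v0 : 0 <= (a * L + D) / e by rewrite divr_ge0 ?addr_ge0// ltW.
  have /andP[_ v1] := truncn_itv v0.
  rewrite -ltr_pdivrMr//; apply: lt_trans v1 _.
  by rewrite -natrX ltr_nat ltn_expl.
have BJ : B J = box crd L.
  apply/seteqP; split => [x []//|x bx]; split => // -[_ /= H].
  have : rho x o <= a * L.
    by apply: (chart_rho_le C) => i; rewrite (chart_mkpK C) subr0; exact: bx.
  have := HD n x n0; move: H HJ; lra.
have := step J; rewrite BJ => /le_trans; apply.
rewrite lee_fin mulrC ler_wpM2r// lerD2l.
apply: ler_wpM2l; first by rewrite mulr_ge0// ltW.
rewrite ler_piMl// ?invr_ge0 ?subr_ge0 ?(ltW q1)//.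
by rewrite gerBl exprn_ge0// ltW.
Qed.

End mismatch.

Lemma neg_powR_ge0 (R : realType) (x p : R) : (0 <= neg_powR x p)%E.
Proof. by rewrite /neg_powR; case: ifP => // _; rewrite lee_fin powR_ge0. Qed.

Lemma measurable_neg_powR dT (T : measurableType dT) (R : realType)
  (g : T -> R) (p : R) : measurable_fun setT g ->
  measurable_fun setT (fun x => neg_powR (g x) p).
Proof.
move=> mg; apply: measurable_fun_ifT.
- exact: measurable_fun_eqr.
- exact: measurable_cst.
- by apply/measurable_EFinP; exact: (measurableT_comp (measurable_powR (- p)) mg).
Qed.

Section tail.
Context (R : realType) (d : nat) dT (T : measurableType dT)
  (mu : {measure set T -> \bar R}) (rho : T -> T -> R) (crd : T -> 'I_d -> R)
  (mkp : ('I_d -> R) -> T) (a : R).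
Context (C : chart mu rho crd mkp a).
Context (P : probability T R) (f : T -> R) (Pf : has_density P mu f).
Context (r delta : R) (r0 : 0 < r) (delta0 : 0 < delta).

Local Notation o := (mkp (fun=> 0)).

Context (moment : (\int[P]_x (rho x o `^ (r + delta))%:E < +oo)%E).
Context (alpha : nat -> seq T) (opt : optimal_codebooks rho r P alpha).

Let d_gt0 := chart_dim C.
Let a0 := chart_const C.
Let rho_ge0 := chart_rho_ge0 C.

Local Notation dist x s := (set_dist rho x [set` s]).
Local Notation z n := (rate R d n).

(** In applications [g x] is [f (c x)]. The hypothesis on the mass of balls is only
    needed for radii up to [b0 * rho x o], because the distance to the codebook
    is at most [2 * rho x o] far from the origin. *)
Theorem distortion_mismatch (s : R) (g : T -> R) (L0 b0 kappa : R) :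
  0 < s -> s < d%:R + r -> 0 < b0 -> 0 < kappa ->
  measurable_fun setT g -> (forall x, 0 <= g x) ->
  {ae P, forall x, L0 < rho x o -> forall t, 0 <= t -> t <= b0 * rho x o ->
    ((kappa * t ^+ d * g x)%:E <= P [set y | (rho y x <= t)%R])%E} ->
  (\int[P]_x neg_powR (g x) (s / (d%:R + r))%R < +oo)%E ->
  exists K : R, forall n, (0 < n)%N ->
    (distortion rho s P [set` alpha n] <= (K * z n `^ s)%:E)%E.
Proof.
move=> s0 sdr b00 k0 mg g0 tail gint.
have [D D0 HD] := dist_optimal_le C Pf r0 delta0 moment opt.
have [K K0 HK] := local_mass C Pf r0 delta0 moment opt.
pose L1 := Num.max (Num.max L0 D) 0.
have L10 : 0 <= L1 by rewrite le_max lexx orbT.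
have LL : L0 <= L1 by rewrite !le_max lexx.
have DL : D <= L1 by rewrite !le_max lexx orbT.
have aL : 0 <= a * L1 by rewrite mulr_ge0// ltW.
have [K1 K10 HK1] :=
  bounded_mismatch C Pf r0 delta0 moment opt aL s0 sdr.
pose w : R := d%:R + r.
have w0 : 0 < w by rewrite ltr_wpDl.
pose sg := s / w.
have sg0 : 0 < sg by rewrite divr_gt0.
pose b := Num.min 4^-1 (b0 / 2).
have b_gt0 : 0 < b by rewrite lt_min invr_gt0 ltr0n divr_gt0.
have b4 : b <= 4^-1 by rewrite ge_min lexx.
have bb0 : b <= b0 / 2 by rewrite ge_min lexx orbT.
(* K + 1 instead of K keeps K4 * (+oo) infinite where g vanishes. *)
pose K4 := (K + 1) / (kappa * b ^+ d).
have kb0 : 0 < kappa * b ^+ d by rewrite mulr_gt0// exprn_gt0.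
have K40 : 0 < K4 by rewrite divr_gt0// ltr_wpDl.
pose I := fine (\int[P]_x neg_powR (g x) sg)%E.
have I0 : (0 <= \int[P]_x neg_powR (g x) sg)%E.
  by apply: integral_ge0 => x _; exact: neg_powR_ge0.
have IE : (\int[P]_x neg_powR (g x) sg = I%:E)%E.
  by rewrite /I fineK// ge0_fin_numE.
exists (K1 + K4 `^ sg * I) => n n0; set e := z n.
have e0 : 0 < e by exact: rate_gt0.
have c1 : 0 < K4 `^ sg * e `^ s.
  by apply: mulr_gt0; exact: powR_gt0.
have c0 := ltW c1.
apply: le_trans (@integral_le_addM _ _ _ P _
  (fun x => (dist x (alpha n) `^ s * \1_(box crd (a * L1)) x)%:E)
  (fun x => neg_powR (g x) sg) _ c0 _ _ _ _ _ _ _) _ => //.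
- exact: measurable_dist_pow C _ _.
- apply/measurable_EFinP; apply: measurable_funM.
    by apply/measurable_EFinP; exact: measurable_dist_pow C _ _.
  exact: measurable_indic (measurable_box C _).
- exact: measurable_neg_powR.
- by move=> x; rewrite lee_fin powR_ge0.
- by move=> x; rewrite lee_fin mulr_ge0 ?powR_ge0.
- by move=> x; exact: neg_powR_ge0.
- apply: filterS tail => x tailx; rewrite indicE.
  have [bx|xb] := boolP (x \in box crd (a * L1)).
    by rewrite mulr1 leeDl// mule_ge0 ?neg_powR_ge0 ?lee_fin.
  rewrite mulr0 add0e /neg_powR; case: ifPn => [_|gx].
    by rewrite gt0_muley ?leey// lte_fin.
  have {}gx : 0 < g x by rewrite lt_neqAle eq_sym gx g0.
  have Lx : L1 < rho x o.
    rewrite ltNge; apply/negP => xL; move/negP: xb; apply; apply/mem_set => i.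
    by apply: le_trans (crd_le_rho C x i) _; rewrite ler_pM2l.
  set Dx := dist x (alpha n).
  have Dx0 : 0 <= Dx by exact: dist_ge0 C _ _.
  have Dx2 : Dx <= 2 * rho x o by have := HD n x n0; rewrite -/Dx; lra.
  have bD : b * Dx <= b0 * rho x o.
    apply: (@le_trans _ _ (b0 / 2 * (2 * rho x o))); last by lra.
    by apply: ler_pM => //; exact: ltW.
  have bD0 : 0 <= b * Dx by rewrite mulr_ge0// ltW.
  have T1 := tailx (le_lt_trans LL Lx) _ bD0 bD.
  have T2 := HK n b x n0 (ltW b_gt0) b4; rewrite -/Dx -/e in T2.
  have T3 : Dx `^ r * (kappa * (b * Dx) ^+ d * g x) <= K * (e `^ r * e ^+ d).
    rewrite -lee_fin EFinM; apply: le_trans T2; apply: lee_wpmul2l T1.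
    by rewrite lee_fin powR_ge0.
  have powE y : 0 <= y -> y `^ r * y ^+ d = y `^ w.
    move=> y0; have [->|y1] := eqVneq y 0.
      by rewrite !powR0 ?gt_eqF// mul0r.
    by rewrite /w powRD ?y1 ?implybT// powR_mulrn// mulrC.
  have T4 : Dx `^ w <= K4 * e `^ w / g x.
    rewrite -!powE ?(ltW e0)// ler_pdivlMr// /K4 [leRHS]mulrAC ler_pdivlMr//.
    apply: (@le_trans _ _ (K * (e `^ r * e ^+ d))); last first.
      apply: ler_wpM2r; last by rewrite lerDl.
      by rewrite mulr_ge0 ?powR_ge0// exprn_ge0// ltW.
    apply: le_trans T3; rewrite exprMn le_eqVlt; apply/orP; left; apply/eqP; ring.
  rewrite -EFinM lee_fin.
  have -> : Dx `^ s = (Dx `^ w) `^ sg.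
    by rewrite -powRrM /sg mulrC divfK// gt_eqF.
  have -> : e `^ s = (e `^ w) `^ sg.
    by rewrite -powRrM /sg mulrC divfK// gt_eqF.
  have -> : g x `^ (- sg) = (g x)^-1 `^ sg by rewrite powRN powRV// ltW.
  have ew0 : 0 <= e `^ w by exact: powR_ge0.
  have gi0 : 0 <= (g x)^-1 by rewrite invr_ge0.
  rewrite -(powRM sg (ltW K40) ew0) -(powRM sg (mulr_ge0 (ltW K40) ew0) gi0).
  by apply: le_powR => //; [exact: ltW|exact: powR_ge0].
apply: (@le_trans _ _ ((K1 * e `^ s)%:E + (K4 `^ sg * e `^ s)%:E * I%:E)%E).
  by apply: leeD; [exact: HK1|rewrite -IE].
by rewrite -EFinM -EFinD lee_fin mulrDl [in leRHS]mulrAC.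
Qed.

End tail.

(** * Charts for norms on row vectors and for the real line *)

Section norm_equivalence.
Context (R : realType) (d : nat) (nrm : 'rV[R]_d -> R) (N : is_norm nrm).

Lemma is_norm0 : nrm 0 = 0.
Proof. by rewrite -(scale0r 0) (is_normZ N) normr0 mul0r. Qed.

Lemma is_normN x : nrm (- x) = nrm x.
Proof. by rewrite -scaleN1r (is_normZ N) normrN1 mul1r. Qed.

Lemma is_norm_ge0 x : 0 <= nrm x.
Proof.
have := is_normD N x (- x); rewrite subrr is_norm0 is_normN; lra.
Qed.

Lemma is_norm_le_coord (x : 'rV[R]_d) t : (forall i, `|x ord0 i| <= t) ->
  nrm x <= (\sum_i nrm (delta_mx ord0 i)) * t.
Proof.
move=> xt; rewrite {1}(row_sum_delta x) mulr_suml.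
have : nrm (\sum_j x 0 j *: delta_mx 0 j) <= \sum_j nrm (x 0 j *: delta_mx 0 j).
  by elim/big_ind2: _ => [|u1 v1 u2 v2 h1 h2|//]; [rewrite is_norm0|
    apply: le_trans (is_normD N _ _) _; exact: lerD].
move=> /le_trans; apply; apply: ler_sum => i _.
by rewrite (is_normZ N) mulrC ler_wpM2l// is_norm_ge0.
Qed.

Let M := \sum_i nrm (delta_mx ord0 i).

Lemma le_coord_mx_norm (x : 'rV[R]_d) i : `|x ord0 i| <= `|x|.
Proof.
rewrite [leRHS]/Num.norm /= mx_normrE.
by apply/bigmax_geP; right => /=; exists (ord0, i).
Qed.

Lemma is_norm_le_mx x : nrm x <= M * `|x|.
Proof. by apply: is_norm_le_coord => i; exact: le_coord_mx_norm. Qed.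

Lemma is_norm_continuous : continuous nrm.
Proof.
have M0 : 0 <= M by apply: sumr_ge0 => i _; exact: is_norm_ge0.
have M1 : 0 < M + 1 by rewrite ltr_wpDl.
move=> x; have F : Filter (nbhs x) by exact: (nbhs_filter (x : 'rV[R]_d)).
apply/cvgrPdist_le => e e0.
have : nbhs x (ball x (e / (M + 1))) by apply: nbhsx_ballx; rewrite divr_gt0.
apply: filterS => y; rewrite -ball_normE /= => xye.
have xy : `|nrm x - nrm y| <= nrm (x - y).
  rewrite ler_norml; apply/andP; split.
    have := is_normD N (y - x) x; rewrite subrK -(is_normN (y - x)) opprB; lra.
  have := is_normD N (x - y) y; rewrite subrK; lra.
apply: le_trans xy _; apply: le_trans (is_norm_le_mx _) _.
apply: (@le_trans _ _ ((M + 1) * `|x - y|)).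
  by rewrite ler_wpM2r// lerDl.
by rewrite mulrC -ler_pdivlMr// ltW.
Qed.

(** By compactness, the norm attains a positive minimum on the unit sphere of the
    supremum norm. *)
Lemma is_norm_ge_mx : (0 < d)%N ->
  exists2 m : R, 0 < m & forall x, m * `|x| <= nrm x.
Proof.
move=> d0; pose S := [set x : 'rV[R]_d | `|x| = 1].
have S0 : S !=set0.
  pose i0 := Ordinal d0; pose v : 'rV[R]_d := delta_mx ord0 i0.
  have v0 : v != 0.
    by apply/eqP => /matrixP/(_ ord0 i0)/eqP; rewrite !mxE !eqxx oner_eq0.
  exists (`|v|^-1 *: v); rewrite /S /= normrZ normfV normr_id mulVf//.
  by rewrite normr_eq0.
have cS : compact S.
  apply: bounded_closed_compact.
    exists 1; split; first exact: num_real.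
    by move=> t t1 x /= ->; exact: ltW.
  rewrite (_ : S = (fun x : 'rV[R]_d => `|x|) @^-1` [set 1]).
    apply: preimage_closed; first by move=> x _; exact: norm_continuous.
    exact: closed_eq.
  by [].
have [c Sc cmin] := EVT_min_rV S0 cS (continuous_subspaceT is_norm_continuous).
move: Sc; rewrite inE /S /= => c1.
have c0 : 0 < nrm c.
  rewrite lt_neqAle is_norm_ge0 andbT eq_sym; apply/eqP => /(is_norm0_eq0 N) cE.
  by move: c1; rewrite cE normr0 => /esym/eqP; rewrite oner_eq0.
exists (nrm c) => // x; have [->|x0] := eqVneq x 0.
  by rewrite normr0 mulr0 is_norm_ge0.
have nx : 0 < `|x| by rewrite normr_gt0.
have := cmin (`|x|^-1 *: x); rewrite (is_normZ N) normfV normr_id.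
rewrite mulrC ler_pdivlMr//; apply.
by rewrite inE /S /= normrZ normfV normr_id mulVf// gt_eqF.
Qed.

Lemma is_norm_equiv : (0 < d)%N -> exists2 A : R, 0 < A &
  (forall (x : 'rV[R]_d) t, (forall i, `|x ord0 i| <= t) -> nrm x <= A * t) /\
  (forall (x : 'rV[R]_d) i, `|x ord0 i| <= A * nrm x).
Proof.
move=> d0; have [m m0 Hm] := is_norm_ge_mx d0.
have M0 : 0 <= M by apply: sumr_ge0 => i _; exact: is_norm_ge0.
have mi0 : 0 < m^-1 by rewrite invr_gt0.
exists (M + m^-1); first by rewrite ltr_wpDl.
split => [x t xt|x i].
  have t0 : 0 <= t by apply: le_trans (xt (Ordinal d0)).
  by apply: le_trans (is_norm_le_coord xt) _; rewrite ler_wpM2r// lerDl ltW.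
apply: le_trans (le_coord_mx_norm _ _) _.
apply: (@le_trans _ _ (m^-1 * nrm x)); first by rewrite ler_pdivlMl.
by rewrite ler_wpM2r ?is_norm_ge0// lerDr.
Qed.

Lemma measurable_is_norm (b : 'rV[R]_d) :
  measurable_fun setT (fun x : 'rV[R]_d => nrm (x - b)).
Proof.
apply: (measurability _ (RGenOpens.measurableE R)).
move=> _ [_ [u [v ->] <-]]; rewrite setTI; apply: sub_sigma_algebra.
apply: open_comp; last exact: interval_open.
move=> x _; apply: continuous_comp; last exact: is_norm_continuous.
have F : Filter (nbhs x) by exact: (nbhs_filter (x : 'rV[R]_d)).
by apply: cvgB; [exact: cvg_id|exact: cvg_cst].
Qed.

Lemma norm_chart : (0 < d)%N -> exists a : R,
  chart (@lebesgue_rV R d) (fun x y : 'rV[R]_d => nrm (x - y))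
    (fun x i => x ord0 i)
    (fun v => \row_i v i) a.
Proof.
move=> d0; have [A A0 [HA1 HA2]] := is_norm_equiv d0; exists A; split => //.
- by move=> v i; rewrite mxE.
- by move=> i; exact: measurable_coord.
- move=> v t t0.
  pose l : 'rV[R]_d := \row_i (v i - t); pose u : 'rV[R]_d := \row_i (v i + t).
  have lu i : l ord0 i <= u ord0 i by rewrite !mxE; lra.
  have := lebesgue_rV_box lu.
  rewrite (_ : [set x : 'rV[R]_d | forall i, l ord0 i <= x ord0 i <= u ord0 i] =
      [set x | forall i, `|x ord0 i - v i| <= t]).
    move=> ->; congr EFin; rewrite (eq_bigr (fun=> 2 * t)).
      by rewrite prodr_const card_ord.
    by move=> i _; rewrite !mxE; ring.
  by apply/seteqP; split => x /= H i; have := H i; rewrite !mxE ler_distl.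
- exact: measurable_is_norm.
- by move=> x y; exact: is_norm_ge0.
- by move=> x y; rewrite -is_normN opprB.
- by move=> x y z; rewrite (le_trans _ (is_normD N _ _))// addrA subrK.
- by move=> x y t H; apply: HA1 => i; have := H i; rewrite !mxE.
- by move=> x y i; have := HA2 (x - y) i; rewrite !mxE.
Qed.

End norm_equivalence.

Lemma real_chart (R : realType) :
  chart (@lebesgue_measure R) (fun x y : measurableTypeR R => `|x - y|)
    (fun (x : measurableTypeR R) (_ : 'I_1) => x) (fun v => v ord0) 1.
Proof.
split => //.
- by move=> v i; rewrite [i]ord1.
- move=> v t t0.
  rewrite (_ : [set x | _] = `[v ord0 - t, v ord0 + t]%classic).
    rewrite lebesgue_measure_itv/= lte_fin -EFinB.
    case: ltP => [_|tt]; first by congr EFin; rewrite expr1; ring.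
    have -> : t = 0 by lra.
    by rewrite mulr0 expr1.
  apply/seteqP; split => x /=; rewrite in_itv/= -ler_distl; first exact.
  by move=> H i; rewrite [i]ord1.
- move=> b; apply: measurableT_comp => //.
  exact: measurable_funB.
- by move=> x y; rewrite distrC.
- by move=> x y z; rewrite -(subrKA y)// ler_normD.
- by move=> x y t /(_ ord0); rewrite mul1r.
- by move=> x y i; rewrite mul1r.
Qed.

(** * Densities with monotone tails *)

Section tools.
Context (R : realType) (d : nat) dT (T : measurableType dT)
  (mu : {measure set T -> \bar R}) (rho : T -> T -> R) (crd : T -> 'I_d -> R)
  (mkp : ('I_d -> R) -> T) (a : R).
Context (C : chart mu rho crd mkp a).
Context (P : probability T R).

(** The ball of radius [t] contains the cube of half-side [t / a]. *)
Lemma density_ball_ge (f : T -> R) (x : T) (t m : R) :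
  has_density P mu f -> 0 <= t -> 0 <= m ->
  (forall y, rho y x <= t -> m <= f y) ->
  (((2 / a) ^+ d * t ^+ d * m)%:E <= P [set y | (rho y x <= t)%R])%E.
Proof.
move=> [mf f0 Pf] t0 m0 fm.
have a0 := chart_const C.
have ta0 : 0 <= t / a by rewrite divr_ge0// ltW.
set B := (X in P X).
have mB : measurable B by exact: measurable_ball_rho C _ _.
pose Q := closed_cube crd (crd x) (t / a).
have mQ : measurable Q by exact: measurable_closed_cube C _ _.
have QB : Q `<=` B.
  move=> y yQ; have := chart_rho_le C yQ.
  by rewrite mulrCA divff ?mulr1// gt_eqF.
apply: (@le_trans _ _ (P Q)); last by apply: le_measure; rewrite ?inE.
rewrite Pf//; apply: (@le_trans _ _ (\int[mu]_(x in Q) (cst m%:E) x)%E).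
  rewrite integral_cst//.
  have -> : mu Q = ((2 * (t / a)) ^+ d)%:E by exact: chart_box C _ _ ta0.
  rewrite -EFinM lee_fin -exprMn mulrC.
  by rewrite (_ : 2 / a * t = 2 * (t / a))//; ring.
apply: ge0_le_integral => //.
- by apply/measurable_EFinP; exact: measurable_funTS mf.
- by move=> y yQ; rewrite lee_fin; apply: fm; exact: (QB y yQ).
Qed.

Lemma optimal_codebooks_of (r : R) (A : nat -> set T) :
  (forall n, (0 < n)%N -> optimal_quantizer rho r P n (A n)) ->
  exists2 alpha : nat -> seq T, optimal_codebooks rho r P alpha &
    forall n, (0 < n)%N -> A n = [set` alpha n].
Proof.
move=> opt.
have /choice[alpha Ha] : forall n, exists s : seq T, (0 < n)%N ->
    [/\ uniq s, (size s <= n)%N & A n = [set` s]].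
  move=> n; case: (posnP n) => [->|n0]; first by exists [::].
  have [_ An _] := opt n n0.
  by have [s Hs] := card_le_seq An; exists s.
exists alpha => n n0; have [us ss AE] := Ha n n0; last exact: AE.
have [A0 _ Amin] := opt n n0; rewrite AE in A0 Amin.
split; [|exact: ss|exact: us|].
  by apply/eqP => E; move: A0; rewrite E set_nil => -[].
move=> s s0 sn; apply: Amin; first exact: set_seq_nonempty.
exact: seq_card_le.
Qed.

Lemma ereal_sup_rate (s K : R) (A : nat -> set T) :
  (forall n, (0 < n)%N ->
    (distortion rho s P (A n) <= (K * rate R d n `^ s)%:E)%E) ->
  (ereal_sup [set (n%:R `^ (s / d%:R))%R%:E * distortion rho s P (A n)
    | n in [set n : nat | (0 < n)%N]] < +oo)%E.
Proof.
move=> H; apply: (@le_lt_trans _ _ K%:E); last exact: ltry.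
apply: ge_ereal_sup => _ [n /= n0 <-].
apply: (@le_trans _ _ ((n%:R `^ (s / d%:R))%:E * (K * rate R d n `^ s)%:E)%E).
  by apply: lee_wpmul2l; [rewrite lee_fin powR_ge0|exact: H].
rewrite -EFinM lee_fin mulrCA.
have -> : rate R d n `^ s = (n%:R `^ (s / d%:R))^-1.
  by rewrite /rate -powRrM -powRN; congr powR; ring.
by rewrite divff ?mulr1// gt_eqF// powR_gt0// ltr0n.
Qed.

End tools.

Section measure_support.
Context (R : realType) (P : probability (measurableTypeR R) R).

(** The real line is second countable, so the complement of the support is a
    countable union of null intervals. *)
Lemma measure_support_ge0 (R0 : R) :
  measure_support (P : set R -> \bar R) `<=` `[R0, +oo[%classic ->
  {ae P, forall x : measurableTypeR R, R0 <= x}.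
Proof.
move=> supp.
pose I (q : rat * rat) : set (measurableTypeR R) := `]ratr q.1, ratr q.2[%classic.
pose F (q : rat * rat) : set (measurableTypeR R) :=
  if `[< P (I q) = 0%E >] then I q else set0.
have mI q : measurable (I q) by exact: measurable_itv.
have mF q : measurable (F q) by rewrite /F; case: ifP => // _.
have FP q : P (F q) = 0%E.
  by rewrite /F; case: ifPn => [/asboolP//|_]; rewrite measure0.
have Fneg : P.-negligible (\bigcup_q F q).
  pose G k : set (measurableTypeR R) :=
    if unpickle k is Some q then F q else set0.
  have -> : \bigcup_q F q = \bigcup_k G k.
    apply/seteqP; split => x [q _ xq].
      by exists (pickle q); [|rewrite /G pickleK].
    move: xq; rewrite /G; case: (unpickle q) => // p xp; by exists p.
  apply: negligible_bigcup => k; rewrite /G; case: (unpickle k) => [q|].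
    by exists (F q); split; [exact: mF|exact: FP|].
  exact: negligible_set0.
apply: negligibleS Fneg => x /= /negP; rewrite -ltNge => xR0.
have : ~ measure_support (P : set R -> \bar R) x.
  by move=> /supp /=; rewrite in_itv/= andbT leNgt xR0.
move=> /existsNP[U /not_implyP[oU /not_implyP[Ux /negP PU]]].
have /nbhs_ballP[e /= e0 xeU] : nbhs x U by exact: open_nbhs_nbhs.
have /rat_in_itvoo[p] : x - e < x by rewrite ltrBlDr ltrDl.
rewrite in_itv/= => /andP[p1 p2].
have /rat_in_itvoo[q] : x < x + e by rewrite ltrDl.
rewrite in_itv/= => /andP[q1 q2].
have IU : I (p, q) `<=` U.
  move=> y; rewrite /I /= in_itv/= => /andP[py yq]; apply: xeU.
  by rewrite -ball_normE /= ltr_distlC; apply/andP; split; lra.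
exists (p, q) => //; rewrite /F.
have -> : `[< P (I (p, q)) = 0%E >].
  apply/asboolP/eqP; rewrite eq_le measure_ge0 andbT.
  have mU : measurable (U : set (measurableTypeR R)) by exact: open_measurable.
  apply: (@le_trans _ _ (P U)); last by rewrite leNgt.
  by apply: le_measure; rewrite ?inE.
by rewrite /I /= in_itv/= p2 q1.
Qed.

End measure_support.

Lemma is_norm_domination (R : realType) (d : nat) (n1 n2 : 'rV[R]_d -> R) :
  (0 < d)%N -> is_norm n1 -> is_norm n2 ->
  exists2 B : R, 0 < B & forall x, n1 x <= B * n2 x.
Proof.
move=> d0 N1 N2; have [A1 A10 [H1 _]] := is_norm_equiv N1 d0.
have [A2 A20 [_ H2]] := is_norm_equiv N2 d0.
by exists (A1 * A2); [exact: mulr_gt0|move=> x; rewrite -mulrA; exact: H1].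
Qed.

Lemma measurable_scale (R : realType) (d : nat) (f : 'rV[R]_d -> R) (c : R) :
  measurable_fun setT f -> measurable_fun setT (fun x : 'rV[R]_d => f (c *: x)).
Proof.
move=> mf; apply: (measurableT_comp mf); apply: measurable_fun_rV => i.
rewrite (_ : (fun x => _) = (fun x : 'rV[R]_d => c * x ord0 i)).
  by apply: measurable_funM => //; exact: measurable_coord.
by apply/funext => x; rewrite mxE.
Qed.

(** If [y] is relatively close to [x], then [nrm0 y] lies between [nrm0 x / 2], which
    exceeds [N], and [c * nrm0 x]; [h] is nonincreasing in this range. *)
Lemma norm_radial_tail (R : realType) (d : nat) (nrm nrm0 : 'rV[R]_d -> R)
    (f : 'rV[R]_d -> R) (h : R -> R) (N c : R) :
  (0 < d)%N -> is_norm nrm -> is_norm nrm0 -> 0 <= N -> 1 < c ->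
  (forall t u, N < t -> t <= u -> h u <= h t) ->
  (forall x, N < nrm0 x -> f x = h (nrm0 x)) ->
  exists L b : R, 0 < b /\ forall x y, L < nrm x -> nrm (y - x) <= b * nrm x ->
    f (c *: x) <= f y.
Proof.
move=> d0 Hn Hn0 N0 c1 hmono fh.
have [B1 B10 HB1] := is_norm_domination d0 Hn Hn0.
have [B2 B20 HB2] := is_norm_domination d0 Hn0 Hn.
pose eta := Num.min (c - 1) 2^-1.
have eta0 : 0 < eta by rewrite lt_min subr_gt0 c1 invr_gt0 ltr0n.
have etac : eta <= c - 1 by rewrite ge_min lexx.
have eta2 : eta <= 2^-1 by rewrite ge_min lexx orbT.
exists (B1 * (2 * N)), (eta / (B1 * B2)).
split => [|x y xL yx]; first by rewrite divr_gt0// mulr_gt0.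
have x0N : 2 * N < nrm0 x.
  by rewrite -(ltr_pM2l B10); apply: lt_le_trans xL (HB1 x).
have yx0 : nrm0 (y - x) <= eta * nrm0 x.
  apply: le_trans (HB2 _) _.
  apply: (@le_trans _ _ (B2 * (eta / (B1 * B2) * (B1 * nrm0 x)))).
    rewrite ler_pM2l//; apply: le_trans yx _.
    by rewrite ler_wpM2l// divr_ge0 ?mulr_ge0// ltW.
  rewrite le_eqVlt; apply/orP; left; apply/eqP.
  by field; rewrite !gt_eqF.
have x00 : 0 <= nrm0 x by lra.
have y1 : nrm0 y <= nrm0 (y - x) + nrm0 x.
  by have := is_normD Hn0 (y - x) x; rewrite subrK.
have y2 : nrm0 x <= nrm0 (x - y) + nrm0 y.
  by have := is_normD Hn0 (x - y) y; rewrite subrK.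
rewrite -(is_normN Hn0 (x - y)) opprB in y2.
have e1 : eta * nrm0 x <= (c - 1) * nrm0 x by rewrite ler_wpM2r.
have e2 : eta * nrm0 x <= 2^-1 * nrm0 x by rewrite ler_wpM2r.
have yN : N < nrm0 y by lra.
have yc : nrm0 y <= c * nrm0 x by lra.
have cx : nrm0 (c *: x) = c * nrm0 x.
  by rewrite (is_normZ Hn0) gtr0_norm//; lra.
rewrite (fh y yN) fh ?cx; last by lra.
exact: hmono.
Qed.

Lemma half_line_tail (R : realType) (f : R -> R) (R0 R0' c : R) : 1 < c ->
  (forall t u, R0' < t -> t <= u -> f u <= f t) ->
  exists L b : R, 0 < b /\ forall x y, R0 <= x -> L < `|x| ->
    `|y - x| <= b * `|x| -> f (c * x) <= f y.
Proof.
move=> c1 fmono.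
exists (`|R0| + 2 * `|R0'|), (Num.min (c - 1) 2^-1).
split=> [|x y R0x Lx]; first by rewrite lt_min subr_gt0 c1 invr_gt0 ltr0n.
have n0 : 0 <= `|R0| by []; have n0' : 0 <= `|R0'| by [].
have x0 : 0 <= x.
  rewrite leNgt; apply/negP => x0; move: Lx; rewrite (ltr0_norm x0).
  have := ler_norm (- R0); rewrite normrN; lra.
rewrite (ger0_norm x0) in Lx *.
set eta := Num.min _ _.
have etac : eta <= c - 1 by rewrite ge_min lexx.
have eta2 : eta <= 2^-1 by rewrite ge_min lexx orbT.
have e1 : eta * x <= (c - 1) * x by rewrite ler_wpM2r.
have e2 : eta * x <= 2^-1 * x by rewrite ler_wpM2r.
have R0n : R0' <= `|R0'| by exact: ler_norm.
rewrite ler_norml => /andP[y1 y2]; apply: fmono; lra.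
Qed.

Theorem corollary3 (R : realType) (r : R) (r_gt0 : 0 < r) :
  (forall (d : nat) (nrm : 'rV[R]_d -> R) (P : probability 'rV[R]_d R)
      (f : 'rV[R]_d -> R) (alpha : nat -> set 'rV[R]_d),
    (0 < d)%N -> is_norm nrm ->
    has_density P (@lebesgue_rV R d) f ->
    (exists2 delta : R, 0 < delta &
      (\int[P]_x (nrm x `^ (r + delta))%R%:E < +oo)%E) ->
    (forall n, (0 < n)%N ->
      optimal_quantizer (fun x y : 'rV[R]_d => nrm (x - y)) r P n (alpha n)) ->
    (exists (nrm0 : 'rV[R]_d -> R) (N : R) (h : R -> R),
      [/\ is_norm nrm0, 0 <= N,
          (forall t, N < t -> 0 <= h t),
          (forall t u, N < t -> t <= u -> h u <= h t) &
          (forall x, N < nrm0 x -> f x = h (nrm0 x))]) ->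
    forall s : R, r < s -> s < d%:R + r ->
    (exists2 c : R, 1 < c &
      (\int[P]_x neg_powR (f (c *: x))%R (s / (d%:R + r))%R < +oo)%E) ->
    (ereal_sup [set (n%:R `^ (s / d%:R))%R%:E *
        distortion (fun x y : 'rV[R]_d => nrm (x - y))%R s P (alpha n)
        | n in [set n : nat | (0 < n)%N]] < +oo)%E)
  /\
  (forall (P : probability (measurableTypeR R) R) (f : R -> R)
      (alpha : nat -> set R),
    has_density P (@lebesgue_measure R) f ->
    (exists2 delta : R, 0 < delta &
      (\int[P]_x (`|x : R| `^ (r + delta))%R%:E < +oo)%E) ->
    (forall n, (0 < n)%N ->
      optimal_quantizer (T := measurableTypeR R) (fun x y : R => `|x - y|)
        r P n (alpha n)) ->
    forall s : R, 1 < s -> s < 1 + r ->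
    (exists R0 : R, measure_support (P : set R -> \bar R)
        `<=` `[R0, +oo[%classic /\
      exists2 R0' : R, R0 <= R0' &
        forall t u, R0' < t -> t <= u -> f u <= f t) ->
    (exists2 c : R, 1 < c &
      (\int[P]_x neg_powR (f (c * x))%R (s / (1 + r))%R < +oo)%E) ->
    (ereal_sup [set (n%:R `^ s)%R%:E *
        distortion (T := measurableTypeR R) (fun x y : R => `|x - y|)%R
          s P (alpha n)
        | n in [set n : nat | (0 < n)%N]] < +oo)%E).
Proof.
split.
- move=> d nrm P f A d0 Hn Pf [delta delta0 mom] opt [nrm0 [N [h [Hn0 N0 _ hmono fh]]]].
  move=> s rs sdr [c c1 int].
  have [a C] := norm_chart Hn d0.
  have o0 : (\row_(i < d) (fun=> 0 : R) i) = 0 by apply/rowP => i; rewrite !mxE.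
  have [alpha oalpha AE] := optimal_codebooks_of opt.
  have [mf f0 _] := Pf.
  have [L [b [b0 tail]]] := norm_radial_tail d0 Hn Hn0 N0 c1 hmono fh.
  have s0 : 0 < s by apply: lt_trans rs.
  have k0 : 0 < (2 / a) ^+ d by rewrite exprn_gt0// divr_gt0// (chart_const C).
  have mom' : (\int[P]_x (nrm (x - \row_(i < d) (fun=> 0 : R) i)
      `^ (r + delta))%:E < +oo)%E.
    by rewrite o0; under eq_integral do rewrite subr0.
  have aetail : {ae P, forall x, L < nrm (x - \row_(i < d) (fun=> 0 : R) i) ->
      forall t, 0 <= t -> t <= b * nrm (x - \row_(i < d) (fun=> 0 : R) i) ->
      (((2 / a) ^+ d * t ^+ d * f (c *: x))%:E <=
        P [set y | (nrm (y - x) <= t)%R])%E}.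
    apply/aeW => x; rewrite o0 subr0 => Lx t t0 tb.
    apply: (density_ball_ge C Pf t0 (f0 _)) => y yx.
    by apply: tail Lx _; exact: le_trans tb.
  have [K HK] := @distortion_mismatch _ _ _ _ _ _ _ _ _ C P f Pf r delta r_gt0
    delta0 mom' alpha oalpha s (fun x => f (c *: x)) L b _ s0 sdr b0 k0
    (measurable_scale c mf) (fun x => f0 _) aetail int.
  apply: (@ereal_sup_rate _ _ _ _ _ P s K) => n n0.
  by rewrite (AE n n0); exact: HK.
- move=> P f A Pf [delta delta0 mom] opt s s1 sr [R0 [supp [R0' R0R0' fmono]]].
  move=> [c c1 int].
  have C := real_chart R.
  have [alpha oalpha AE] := optimal_codebooks_of opt.
  have [mf f0 _] := Pf.
  have [L [b [b0 tail]]] := half_line_tail R0 c1 fmono.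
  have s0 : 0 < s by apply: lt_trans s1.
  have k0 : 0 < (2 / 1 : R) ^+ 1 by rewrite exprn_gt0// divr_gt0.
  have mom' : (\int[P]_x (`|(x : R) - 0| `^ (r + delta))%:E < +oo)%E.
    by under eq_integral do rewrite subr0.
  have mg : measurable_fun setT (fun x : measurableTypeR R => f (c * x)).
    by apply: (measurableT_comp mf); exact: measurable_funM.
  have aetail : {ae P, forall x : measurableTypeR R, L < `|(x : R) - 0| ->
      forall t, 0 <= t -> t <= b * `|(x : R) - 0| ->
      (((2 / 1) ^+ 1 * t ^+ 1 * f (c * x))%:E <=
        P [set y : measurableTypeR R | (`|(y : R) - x| <= t)%R])%E}.
    apply: filterS (measure_support_ge0 supp) => x R0x; rewrite subr0 => Lx t t0 tb.
    apply: (density_ball_ge C Pf t0 (f0 _)) => y yx.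
    by apply: tail R0x Lx _; exact: le_trans tb.
  have [K HK] := @distortion_mismatch _ _ _ _ _ _ _ _ _ C P f Pf r delta r_gt0
    delta0 mom' alpha oalpha s (fun x => f (c * x)) L b _ s0 sr b0 k0
    mg (fun x => f0 _) aetail int.
  have HA n : (0 < n)%N ->
    (distortion (fun x y : measurableTypeR R => (`|x - y|)%R)
      s P (A n) <= (K * rate R 1 n `^ s)%:E)%E.
    by move=> n0; rewrite (AE n n0); exact: HK.
  have := ereal_sup_rate HA.
  have -> : s / 1%:R = s by exact: divr1.
  exact.
Qed.
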